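(* Let $d\ge2$ and $0<p<p_c(d)$. There exists a constant $C=C(p)$ (for the given dimension $d$) such that for every $t>0$ and every deterministic connected bounded set $\Gamma\subset\mathbf{R}^d$ with $\frac12 tB_d\subset\Gamma\subset 2tB_d$, $$E K_\Gamma\le C\,t,$$ where $K_\Gamma$ is the number of edges $e$ of $\Gamma'$ such that $t(e)=1$ and some route for $T_\Gamma(\mathbf{0},\partial\Gamma)$ passes through $e$.
   Context: First passage percolation on $\mathbf{Z}^d$: edges join pairs of vertices at Euclidean distance $1$. Each edge $e$ is independently assigned $t(e)\in\{0,1\}$ with $P(t(e)=0)=p$, $P(t(e)=1)=1-p$; $E$ is expectation under the product measure $P=P_p$. $p_c(d)$ is the critical probability of Bernoulli bond percolation on $\mathbf{Z}^d$. A path $\gamma$ is a finite alternating sequence $(v_0,e_1,v_1,\dots,e_n,v_n)$ of vertices and edges, each $e_i$ joining $v_{i-1}$ and $v_i$; $T(\gamma)=\sum_{i=1}^n t(e_i)$. $T(u,v)$ is the infimum of $T(\gamma)$ over paths from $u$ to $v$; for $x,y\in\mathbf{R}^d$, $T(x,y)=T(x',y')$ with $x',y'$ the nearest vertices of $\mathbf{Z}^d$ (ties broken by a fixed order). For $x\in\mathbf{R}^d$, $\mu_p(x)=\lim_{n\to\infty}\frac1n T(\mathbf{0},nx)$ (a.s. and in $L_1$, non-random). For $p<p_c(d)$, $\mu_p$ is a norm and $B_d=B_d(p)=\{x:\mu_p(x)\le1\}$ is compact and convex. For $\Gamma\subset\mathbf{R}^d$ put $\Gamma'=\Gamma\cap\mathbf{Z}^d$,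 and let $\partial\Gamma'$ be the set of vertices of $\Gamma'$ adjacent to at least one vertex of $\mathbf{Z}^d\setminus\Gamma'$. An edge of $\Gamma'$ is an edge with both endpoints in $\Gamma'$. Define $$T_\Gamma(\mathbf{0},\partial\Gamma)=\inf\{T(\gamma):\gamma\subset\Gamma'\text{ is a path from }\mathbf{0}\text{ to some vertex of }\partial\Gamma'\};$$ a route for $T_\Gamma(\mathbf{0},\partial\Gamma)$ is a path $\gamma\subset\Gamma'$ from $\mathbf{0}$ to $\partial\Gamma'$ attaining this infimum. *)

(* Defs.v *)
From mathcomp Require Import all_boot all_order all_algebra.
From mathcomp Require Import all_classical all_reals all_analysis.
From mathcomp Require Import lra.
Set Implicit Arguments.
Unset Strict Implicit.
Unset Printing Implicit Defensive.
Import Order.TTheory GRing.Theory Num.Theory.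
Import numFieldNormedType.Exports.
Local Open Scope classical_set_scope.
Local Open Scope ring_scope.

Section lattice.
Variable d : nat.

Definition vertex := 'rV[int]_d.

Definition adjacent (u v : vertex) : bool :=
  \sum_(i < d) (u 0 i - v 0 i) ^+ 2 == 1.

(* The pair (z, i) encodes the undirected edge {z, z + e_i}, e_i being the
   i-th unit vector; by [adjacentP] and [joins_inj] this enumerates the pairs
   of vertices at Euclidean distance 1, each exactly once. *)
Definition edge := (vertex * 'I_d)%type.

Definition tip (e : edge) : vertex := e.1 + delta_mx 0 e.2.

Definition joins (e : edge) (u v : vertex) : bool :=
  ((u == e.1) && (v == tip e)) || ((v == e.1) && (u == tip e)).

Lemma adjacentP (u v : vertex) : adjacent u v <-> exists e, joins e u v.
Proof.
split; last first.
  have H (w : vertex) i : \sum_(j < d) ((w + delta_mx 0 i) 0 j - w 0 j) ^+ 2 = 1.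
    rewrite (bigD1 i) //= big1 => [|j ji]; rewrite !mxE /= ?eqxx /=.
      by rewrite addrAC subrr add0r addr0.
    by rewrite (negbTE ji) addr0 subrr expr0n.
  case=> -[w i]; rewrite /joins /tip /adjacent => /orP[]/andP[/eqP-> /eqP->] /=.
    by apply/eqP; rewrite -[RHS](H w i); apply: eq_bigr => j _; rewrite -sqrrN opprB.
  by apply/eqP; rewrite -[RHS](H w i).
rewrite /adjacent => /eqP s1.
have [i ni] : exists i, u 0 i != v 0 i.
  apply/existsP; apply: contraPT s1 => /existsPn h.
  by rewrite big1 // => i _; move: (h i); rewrite negbK => /eqP->; rewrite subrr.
have sq1 (x : int) : x != 0 -> 1 <= x ^+ 2.
  by move=> x0; rewrite -gtz0_ge1 exprn_even_gt0.
move: s1; rewrite (bigD1 i) //= => s1.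
have r0 : 0 <= \sum_(j < d | j != i) (u 0 j - v 0 j) ^+ 2.
  by apply: sumr_ge0 => j _; exact: sqr_ge0.
have i1 : 1 <= (u 0 i - v 0 i) ^+ 2 by apply: sq1; rewrite subr_eq0.
have i1' : (u 0 i - v 0 i) ^+ 2 = 1 by lra.
have /eqP : \sum_(j < d | j != i) (u 0 j - v 0 j) ^+ 2 = 0 by lra.
rewrite psumr_eq0 => [/allP h|j _]; last exact: sqr_ge0.
have uv j : j != i -> u 0 j = v 0 j.
  move=> ji; have := h j; rewrite mem_index_enum ji /= => /(_ isT).
  by rewrite sqrf_eq0 subr_eq0 => /eqP.
move/eqP: i1'; rewrite sqrf_eq1 => /orP[]/eqP e1.
- exists (v, i); rewrite /joins /tip eqxx /=; apply/orP; right.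
  apply/eqP/rowP => j; rewrite !mxE /=; case: eqP => [->|/eqP ji] /=.
    by rewrite -e1 addrC subrK.
  by rewrite addr0 uv.
- exists (u, i); rewrite /joins /tip eqxx /=; apply/orP; left.
  apply/eqP/rowP => j; rewrite !mxE /=; case: eqP => [->|/eqP ji] /=.
    by rewrite -[1]opprK -e1 opprB addrC subrK.
  by rewrite addr0 uv.
Qed.

Lemma joins_inj (e f : edge) (u v : vertex) :
  joins e u v -> joins f u v -> e = f.
Proof.
have dI (i j : 'I_d) : delta_mx 0 i = delta_mx 0 j :> vertex -> i = j.
  move=> /rowP/(_ i); rewrite !mxE !eqxx /=.
  by case: eqP.
have dN (i j : 'I_d) : delta_mx 0 i + delta_mx 0 j != 0 :> vertex.
  apply/eqP => /rowP/(_ i); rewrite !mxE !eqxx /=.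
  by case: (_ == _).
case: e f => [a i] [b j]; rewrite /joins /tip /=.
case/orP=> /andP[/eqP-> /eqP->]; case/orP=> /andP[/eqP h1 /eqP h2].
- by move: h2; rewrite h1 => /addrI/dI ->.
- by move: h1; rewrite h2 -addrA => /eqP; rewrite -subr_eq0 addrAC subrr add0r addrC (negbTE (dN _ _)).
- by move: h1; rewrite h2 -addrA => /eqP; rewrite -subr_eq0 addrAC subrr add0r addrC (negbTE (dN _ _)).
- by move: h2; rewrite h1 => /addrI/dI ->.
Qed.

(* A path (u, e_1, v_1, ..., e_n, v_n) is given by its first vertex u and the
   sequence [:: (e_1, v_1); ...; (e_n, v_n)], empty when n = 0. *)
Definition steps := seq (edge * vertex).

Fixpoint is_path (u : vertex) (g : steps) : bool :=
  if g is (e, v) :: g' then joins e u v && is_path v g' else true.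

Definition path_end (u : vertex) (g : steps) : vertex := last u (unzip2 g).

Definition path_in (D : set vertex) (u : vertex) (g : steps) : Prop :=
  is_path u g /\ (forall v, v \in u :: unzip2 g -> D v).

End lattice.

Section model.
Variables (R : realType) (d : nat).

(* w e is t(e): [false] stands for 0 and [true] for 1. *)
Definition cylinders : set (set (edge d -> bool)) :=
  [set A | exists e b, A = [set w | w e = b]].

Definition config := g_sigma_algebraType cylinders.

Definition passage (w : config) (e : edge d) : R := (w e)%:R.

(* By the pi-lambda theorem at most one P satisfies this; it is the product
   over the edges of the law with mass p at 0 and 1 - p at 1. *)
Definition is_product_measure (p : R) (P : probability config R) : Prop :=
  forall (s : seq (edge d)) (b : edge d -> bool), uniq s ->
    P [set w : config | forall e, e \in s -> w e = b e] =
    (\prod_(e <- s) (if b e then 1 - p else p))%:E.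

(* Open edges are those with t(e) = 0, so that under the product measure of
   parameter q each edge is open with probability q. *)
Definition open_cluster (w : config) : set (vertex d) :=
  [set v | exists g, [/\ is_path 0 g, path_end 0 g = v &
    forall e, e \in unzip1 g -> w e = false]].

Definition critical_probability : R :=
  sup [set q : R | 0 <= q <= 1 /\
    exists P : probability config R, is_product_measure q P /\
      P [set w : config | infinite_set (open_cluster w)] = 0%E].

Definition path_time (w : config) (g : steps d) : R :=
  \sum_(e <- unzip1 g) passage w e.

Definition vertex_time (w : config) (u v : vertex d) : R :=
  inf [set path_time w g | g in [set g | is_path u g /\ path_end u g = v]].

(* The nearest vertex to x; among several nearest ones, the lexicographically
   largest. *)
Definition nearest_vertex (x : 'rV[R]_d) : vertex d :=
  \row_i Num.floor (x 0 i + 2^-1).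

Lemma nearest_vertex_le (x : 'rV[R]_d) (v : vertex d) :
  \sum_(i < d) (x 0 i - (nearest_vertex x 0 i)%:~R) ^+ 2 <=
  \sum_(i < d) (x 0 i - (v 0 i)%:~R) ^+ 2.
Proof.
apply: ler_sum => i _; rewrite mxE.
have := floor_le (x 0 i + 2^-1); have := floorD1_gt (x 0 i + 2^-1).
rewrite intrD; set m := Num.floor _ => h1 h2.
have [vm|mv|->//] := ltgtP (v 0 i) m.
- have : (v 0 i + 1)%:~R <= m%:~R :> R by rewrite ler_int lezD1.
  by rewrite intrD; nra.
- have : (m + 1)%:~R <= (v 0 i)%:~R :> R by rewrite ler_int lezD1.
  by rewrite intrD; nra.
Qed.

Definition point_time (w : config) (x y : 'rV[R]_d) : R :=
  vertex_time w (nearest_vertex x) (nearest_vertex y).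

Section time_constant.
Variable P : probability config R.

(* [xget] picks the almost sure limit, which is unique because P has mass 1. *)
Definition time_constant (x : 'rV[R]_d) : R :=
  xget 0 [set m : R | {ae P, forall w : config,
    (fun n : nat => n%:R^-1 * point_time w 0 (n%:R *: x)) @ \oo --> m}].

Definition limit_ball : set 'rV[R]_d := [set x | time_constant x <= 1].

End time_constant.

Definition dilate (a : R) (A : set 'rV[R]_d) : set 'rV[R]_d :=
  [set a *: x | x in A].

Definition lattice_points (G : set 'rV[R]_d) : set (vertex d) :=
  [set v | G (map_mx intr v)].

Definition inner_boundary (D : set (vertex d)) : set (vertex d) :=
  [set v | D v /\ exists u, adjacent v u /\ ~ D u].

Definition exit_paths (G : set 'rV[R]_d) : set (steps d) :=
  [set g | path_in (lattice_points G) 0 g /\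
           inner_boundary (lattice_points G) (path_end 0 g)].

Definition exit_time (G : set 'rV[R]_d) (w : config) : R :=
  inf [set path_time w g | g in exit_paths G].

Definition is_route (G : set 'rV[R]_d) (w : config) (g : steps d) : Prop :=
  exit_paths G g /\ path_time w g = exit_time G w.

Definition route_edges (G : set 'rV[R]_d) (w : config) : set (edge d) :=
  [set e | [/\ lattice_points G e.1, lattice_points G (tip e),
    passage w e = 1 & exists g, is_route G w g /\ e \in unzip1 g]].

(* [counting] is the number of elements, +oo on infinite sets. *)
Definition num_route_edges (G : set 'rV[R]_d) (w : config) : \bar R :=
  counting (route_edges G w).

End model.

(* Main.v *)
Require Import Defs.
From mathcomp Require Import all_boot all_order all_algebra.
From mathcomp Require Import all_classical all_reals all_analysis.
From mathcomp Require Import measurable_realfun finmap zify ring lra.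
Import Order.TTheory GRing.Theory Num.Theory.
Import numFieldNormedType.Exports.
Local Open Scope classical_set_scope.
Local Open Scope ring_scope.

(** The number of closed edges (passage time 1) on routes is compared with the
    number of open edges (passage time 0) that lie on all routes, and the latter
    is at most the length of a shortest route.

    Call an edge e pivotal if the crossing time T of the domain is smaller when e
    is open than when e is closed.  A closed edge on some route is pivotal, since
    opening it shortens that route ([on_route_pivotal]); an open pivotal edge lies
    on every route, since a route avoiding it would survive its closing
    ([open_pivotal_in_optimal]).  Being pivotal does not depend on the state of e
    itself, so that p E[closed pivotal edges] = (1 - p) E[open pivotal edges]
    ([pivotal_exchange]).  It remains to show that some route has length O(t) in
    mean.

    Since p is subcritical, there is a finite set S containing 0 such that the
    expected number phi_p(S) of open edges through which the cluster of 0 in S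
    leaves S is less than 1 ([critical_set]).  This is the theorem of
    Duminil-Copin and Tassion: otherwise Russo's formula would give
    theta' >= 1 - theta on an interval [p, q] to the right of p, uniformly in the
    finite domain, and there would be percolation at q ([subcritical_set]).

    A route is then cut into windows that are translates of S.  In each window the
    open cluster of the entrance is explored, the route is followed from its last
    exit of that cluster, and the cluster is removed from the domain, so that
    successive windows are independent.  Open exits contribute phi_p(S) < 1 in
    mean, and a closed exit is charged a small factor lam, so the expected total weight
    of the chains of m windows decays like rho^m with rho < 1 ([mean_chain]).  A
    crossing time at most k forces a chain of weight at least lam^k unless a route
    with at most m #|S| steps exists ([short_or_chain]).  Hence the mean length of
    the shortest route is O(k), for k >= 1 ([mean_open_pivotals]).

    Finally k may be taken to be the number of lattice steps that one can make
    along a coordinate axis without leaving G, and this must be O(t).  As G is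
    bounded and contains a dilate of the limit ball, some point s0 e of the axis is
    outside the limit ball; there the time constant exceeds 1 and is a true limit,
    and by scaling it exceeds 1 at all further points of the axis
    ([limit_ball_axis]), so that k <= 2 s0 t.  The constant s0 depends on p and d
    only because the product measure is unique ([is_product_measure_unique]). *)

Set Implicit Arguments.
Unset Strict Implicit.
Unset Printing Implicit Defensive.

(** * Averages over finitely many independent edges *)

Section mean.
Variables (R : realType) (E : eqType).
Implicit Types (p q : R) (s : seq E) (w : E -> bool) (f g : (E -> bool) -> R).

Definition upd w (e : E) (b : bool) : E -> bool :=
  fun x => if x == e then b else w x.

(** Resamples the coordinates listed in s, each equal to false with probability p,
    and keeps those of w elsewhere.  This finite average makes sense for every p
    at once, which allows one to differentiate in p; it is the expectation under
    the product measure when f depends on s only (see [prob_local]). *)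
Fixpoint mean p s f w : R :=
  if s is e :: s' then
    p * mean p s' f (upd w e false) + (1 - p) * mean p s' f (upd w e true)
  else f w.

Definition local_on T (D : set E) (h : (E -> bool) -> T) :=
  forall w w', (forall e, D e -> w e = w' e) -> h w = h w'.

Lemma upd_upd w e b b' : upd (upd w e b) e b' = upd w e b'.
Proof. by apply/funext => x; rewrite /upd; case: eqP. Qed.

Lemma updC w e e' b b' : e != e' ->
  upd (upd w e b) e' b' = upd (upd w e' b') e b.
Proof.
by move=> ee'; apply/funext => x; rewrite /upd; case: eqP => // ->; rewrite eq_sym (negbTE ee').
Qed.

Lemma upd_id w e : upd w e (w e) = w.
Proof. by apply/funext => x; rewrite /upd; case: eqP => // ->. Qed.

Lemma local_upd T D (h : (E -> bool) -> T) w e b :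
  local_on D h -> ~ D e -> h (upd w e b) = h w.
Proof.
by move=> hD De; apply: hD => x Dx; rewrite /upd; case: eqP => // xe; rewrite xe in Dx.
Qed.

Lemma local_onS T (D D' : set E) (h : (E -> bool) -> T) :
  D `<=` D' -> local_on D h -> local_on D' h.
Proof. by move=> DD' hD w w' ww'; apply: hD => e /DD'; exact: ww'. Qed.

Lemma mean_add p s f g w :
  mean p s (fun w => f w + g w) w = mean p s f w + mean p s g w.
Proof. by elim: s w => //= e s IH w; rewrite !IH; ring. Qed.

Lemma mean_scale p s c f w : mean p s (fun w => c * f w) w = c * mean p s f w.
Proof. by elim: s w => //= e s IH w; rewrite !IH; ring. Qed.

Lemma mean_cst p s c w : mean p s (fun=> c) w = c.
Proof. by elim: s w => //= e s IH w; rewrite !IH; ring. Qed.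

Lemma mean_sum p s (I : Type) (r : seq I) (P : pred I) (F : I -> (E -> bool) -> R) w :
  mean p s (fun w => \sum_(i <- r | P i) F i w) w =
  \sum_(i <- r | P i) mean p s (F i) w.
Proof.
elim: r => [|i r IH].
  rewrite big_nil -[RHS](mean_cst p s 0 w); congr mean.
  by apply/funext => w'; rewrite big_nil.
rewrite big_cons -IH; case Pi: (P i).
  by rewrite -mean_add; congr mean; apply/funext => w'; rewrite big_cons Pi.
by congr mean; apply/funext => w'; rewrite big_cons Pi.
Qed.

Lemma le_mean p s f g w : 0 <= p <= 1 -> (forall w, f w <= g w) ->
  mean p s f w <= mean p s g w.
Proof.
move=> /andP[p0 p1] fg; elim: s w => //= e s IH w.
by apply: lerD; apply: ler_wpM2l => //; rewrite subr_ge0.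
Qed.

Lemma mean_ge0 p s f w : 0 <= p <= 1 -> (forall w, 0 <= f w) -> 0 <= mean p s f w.
Proof. by move=> p01 f0; rewrite -(mean_cst p s 0 w); exact: le_mean. Qed.

Lemma mean_singletonC p s e f w :
  mean p s (fun w => mean p [:: e] f w) w = mean p (e :: s) f w.
Proof.
elim: s w => //= e' s IH w; rewrite !IH /=.
have [->|ee'] := eqVneq e e'; first by rewrite !upd_upd; ring.
rewrite ![upd (upd _ e _) e' _]updC //; ring.
Qed.

Lemma mean_cat p s s' f w : mean p (s ++ s') f w = mean p s (mean p s' f) w.
Proof. by elim: s w => //= e s IH w; rewrite !IH. Qed.

Lemma meanC p s s' f w : mean p (s ++ s') f w = mean p (s' ++ s) f w.
Proof.
rewrite !mean_cat; elim: s f w => [|e s IH] f w; first by [].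
have -> : mean p (e :: s) f = fun w => mean p [:: e] (mean p s f) w by [].
rewrite -[RHS](_ : mean p (e :: s') (mean p s f) w = _); last first.
  by rewrite -mean_singletonC.
by rewrite /= !IH.
Qed.

Lemma local_mean p s D f :
  local_on D f -> local_on (D `\` [set` s]) (mean p s f).
Proof.
elim: s D => [|e s IH] D fD w w' ww' /=.
  by apply: fD => x Dx; apply: ww'; split.
by congr (_ * _ + _ * _); apply: (IH D) => // x [Dx xs]; rewrite /upd;
  case: eqP => // /eqP xe; apply: ww'; split => //=; rewrite inE (negbTE xe).
Qed.

(** A local function has the same mean for any list of resampled coordinates that
    contains those it looks at, and for any base configuration: each list may be
    enlarged to the concatenation of the two, in either order. *)
Lemma mean_local p s s' D f w w' : local_on D f ->
  (forall e, D e -> e \in s) -> (forall e, D e -> e \in s') ->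
  mean p s f w = mean p s' f w'.
Proof.
move=> fD Ds Ds'.
have K r (Dr : forall e, D e -> e \in r) u u' : mean p r f u = mean p r f u'.
  by apply: (@local_mean p r D f fD u u') => x [/Dr xr]; rewrite /= xr.
have -> : mean p s f w = mean p (s' ++ s) f w.
  rewrite mean_cat (_ : mean p s f = fun=> mean p s f w) ?mean_cst //.
  by apply/funext => u; exact: K.
rewrite meanC mean_cat (_ : mean p s' f = fun=> mean p s' f w') ?mean_cst //.
by apply/funext => u; exact: K.
Qed.

Lemma mean_indep p s D D' f g w : local_on D f -> local_on D' g ->
  (forall e, D e -> ~ D' e) ->
  mean p s (fun w => f w * g w) w = mean p s f w * mean p s g w.
Proof.
move=> fD gD' DD'; elim: s w => //= e s IH w; rewrite !IH.
have [De|De] := pselect (D e).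
  have ge b : mean p s g (upd w e b) = mean p s g w.
    by apply: (local_upd _ _ (@local_mean p s D' g gD')) => -[]/DD'/=; case.
  by rewrite !ge; ring.
have fe b : mean p s f (upd w e b) = mean p s f w.
  by apply: (local_upd _ _ (@local_mean p s D f fD)) => -[].
by rewrite !fe; ring.
Qed.

(** Invariance under relabeling of the coordinates; translations are the case of
    interest. *)
Lemma mean_inj p s (h : E -> E) f w : injective h ->
  mean p (map h s) (fun w => f (w \o h)) w = mean p s f (w \o h).
Proof.
move=> hI; elim: s w => //= e s IH w; rewrite !IH.
have u b : upd w (h e) b \o h = upd (w \o h) e b.
  by apply/funext => x; rewrite /upd /= (inj_eq hI).
by rewrite !u.
Qed.

Definition antitone f := forall w w', (forall e, w e ==> w' e) -> f w' <= f w.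

Lemma antitone_mean p s f : 0 <= p <= 1 -> antitone f -> antitone (mean p s f).
Proof.
move=> /andP[p0 p1] fa; elim: s => //= e s IH w w' ww'.
by apply: lerD; apply: ler_wpM2l; rewrite ?subr_ge0 //; apply: IH => x;
  rewrite /upd; case: eqP.
Qed.

(** Raising p switches more coordinates to false, which can only increase an
    antitone function. *)
Lemma mean_monotone p q s f w : 0 <= p -> p <= q -> q <= 1 -> antitone f ->
  mean p s f w <= mean q s f w.
Proof.
move=> p0 pq q1 fa; elim: s w => //= e s IH w.
have q0 : 0 <= q := le_trans p0 pq.
have p1 : p <= 1 := le_trans pq q1.
have h0 := IH (upd w e false); have h1 := IH (upd w e true).
have : mean q s f (upd w e true) <= mean q s f (upd w e false).
  by apply: antitone_mean; rewrite ?q0 // => x; rewrite /upd; case: eqP => // _; exact: implybb.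
rewrite -subr_ge0 => h; rewrite -subr_ge0 in h0; rewrite -subr_ge0 in h1.
have := mulr_ge0 p0 h0; have := @mulr_ge0 _ (1 - p) _ _ h1.
have := @mulr_ge0 _ (q - p) _ _ h.
rewrite !subr_ge0 => /(_ pq) k1 /(_ p1) k2 k3; lra.
Qed.

Definition influence f e w := f (upd w e false) - f (upd w e true).

Lemma mean_upd p s f w e b : e \notin s ->
  mean p s (fun w => f (upd w e b)) w = mean p s f (upd w e b).
Proof.
elim: s w => //= e' s IH w; rewrite inE negb_or => /andP[ee' es].
by rewrite !IH // !(@updC w e' e _ b) // eq_sym.
Qed.

Lemma mean_influence p s f w e b : e \notin s ->
  mean p s (influence f e) (upd w e b) =
  mean p s f (upd w e false) - mean p s f (upd w e true).
Proof.
move=> es; rewrite /influence.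
have -> : (fun w => f (upd w e false) - f (upd w e true)) =
  fun w => f (upd w e false) + (-1) * f (upd w e true).
  by apply/funext => u; ring.
by rewrite mean_add mean_scale !mean_upd // !upd_upd; ring.
Qed.

(** Russo's formula.  The mean is affine in the parameter of each single
    coordinate, with slope the mean influence of that coordinate, and the chain
    rule adds the slopes up. *)
Lemma is_derive_mean (x : R) s f w : uniq s ->
  is_derive x (1 : R) (fun x => mean x s f w)
    (\sum_(e <- s) mean x s (influence f e) w).
Proof.
elim: s w => [|e s IH] w /=.
  by move=> _; rewrite big_nil; exact: is_derive_cst.
move=> /andP[es us]; rewrite big_cons.
have h0 := IH (upd w e false) us; have h1 := IH (upd w e true) us.
pose F b := fun x => mean x s f (upd w e b).
have e0 : (fun x : R => x * mean x s f (upd w e false) + (1 - x) * mean x s f (upd w e true))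
  = (id * F false + (cst 1 - id) * F true)%R by [].
rewrite e0; have d0 : is_derive x (1 : R) (F false) _ := h0.
have d1 : is_derive x (1 : R) (F true) _ := h1.
apply: is_derive_eq.
rewrite mean_influence // mean_influence //.
have -> : \sum_(j <- s) (x * mean x s (influence f j) (upd w e false) +
    (1 - x) * mean x s (influence f j) (upd w e true)) =
  x * (\sum_(j <- s) mean x s (influence f j) (upd w e false)) +
  (1 - x) * (\sum_(j <- s) mean x s (influence f j) (upd w e true)).
  by rewrite !mulr_sumr -big_split.
rewrite /F /= /GRing.scale /=.
have -> : (cst 1 - id) x = 1 - x by [].
ring.
Qed.

End mean.

(** * Clusters of edges of passage time zero, and costs of paths *)

Section lattice.
Variable d : nat.
Notation cfg := (edge d -> bool).
Notation dir := ('I_d * bool)%type.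
Implicit Types (x y v : vertex d) (e : edge d) (w : cfg) (A C D S : {fset vertex d}).

Definition unitv (i : 'I_d) : vertex d := delta_mx 0 i.

(** The endpoint of the step that leaves x in the direction +- e_i, the sign being
    the boolean; [ed] is the edge crossed by that step. *)
Definition nb x (l : dir) : vertex d :=
  if l.2 then x + unitv l.1 else x - unitv l.1.

Definition ed x (l : dir) : edge d :=
  if l.2 then (x, l.1) else (x - unitv l.1, l.1).

Lemma joins_ed x l : joins (ed x l) x (nb x l).
Proof.
case: l => i [] ; rewrite /joins /ed /nb /tip /= ?eqxx //=.
by rewrite subrK !eqxx orbT.
Qed.

Lemma joins_edP e x y : reflect (exists l, e = ed x l /\ y = nb x l) (joins e x y).
Proof.
apply: (iffP idP) => [|[l [-> ->]]]; last exact: joins_ed.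
case: e => z i; rewrite /joins /tip /= => /orP[]/andP[/eqP-> /eqP->].
  by exists (i, true).
by exists (i, false); rewrite /ed /nb /= addrK.
Qed.

Definition inside A : set (edge d) := [set e | e.1 \in A /\ tip e \in A].

Lemma inside_joins A e x y : joins e x y -> inside A e <-> x \in A /\ y \in A.
Proof.
by rewrite /joins /inside /= => /orP[]/andP[/eqP-> /eqP->]; tauto.
Qed.

Lemma inside_ed A x l : inside A (ed x l) <-> x \in A /\ nb x l \in A.
Proof. exact: inside_joins (joins_ed x l). Qed.

Lemma insideS A D : (A `<=` D)%fset -> inside A `<=` inside D.
Proof. by move=> /fsubsetP AD e [h1 h2]; split; exact: AD. Qed.

Definition inside_seq A : seq (edge d) :=
  [seq e <- [seq (x, i) | x <- A, i <- enum 'I_d] | tip e \in A].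

Lemma mem_inside A e : reflect (inside A e) (e \in inside_seq A).
Proof.
rewrite mem_filter; apply: (iffP andP) => [[h /allpairsP[[x i] /= [h1 _ h2]]]|[h1 h2]].
  by split=> //; rewrite h2.
split=> //; apply/allpairsP; exists e; rewrite /= mem_enum; split=> //.
by case: e {h1 h2}.
Qed.

Lemma uniq_inside A : uniq (inside_seq A).
Proof.
apply: filter_uniq; apply: allpairs_uniq; rewrite ?enum_uniq ?fset_uniq //.
by move=> [x i] [y j] _ _ /= [-> ->].
Qed.

(** The endpoint in C determines the direction in which an edge leaves C, so
    counting exit steps or exit edges is the same. *)
Lemma ed_exit_inj C x y l l' : x \in C -> nb x l \notin C -> y \in C ->
  nb y l' \notin C -> ed x l = ed y l' -> (x, l) = (y, l').
Proof.
case: l => i b; case: l' => j b'; rewrite /ed /nb /=.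
case: b; case: b' => /= xC nx yC ny [].
- by move=> -> ->.
- by move=> e1 ij; move: nx; rewrite e1 ij subrK yC.
- by move=> e1 ij; move: ny; rewrite -e1 ij subrK xC.
- by move=> e1 ij; move: e1; rewrite ij => /addIr ->.
Qed.

(** Edges of passage time zero, i.e. carrying the value false, are the open ones. *)
Definition oadj w x y : bool := [exists l : dir, (nb x l == y) && ~~ w (ed x l)].

Lemma oadjP w x y :
  reflect (exists l, nb x l = y /\ w (ed x l) = false) (oadj w x y).
Proof.
apply: (iffP existsP) => -[l].
  by move=> /andP[/eqP h /negbTE h']; exists l.
by move=> [h h']; exists l; rewrite h h' eqxx.
Qed.

(** For v in A, connection to v by open edges inside A. *)
Inductive reach w A v : vertex d -> Prop :=
| reach_refl : reach w A v v
| reach_step x y : reach w A v x -> oadj w x y -> y \in A -> reach w A v y.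

Lemma reach_in w A v x : v \in A -> reach w A v x -> x \in A.
Proof. by move=> vA; case. Qed.

Lemma reachS w A D v x : (A `<=` D)%fset -> reach w A v x -> reach w D v x.
Proof.
move=> /fsubsetP AD; elim; first exact: reach_refl.
by move=> y z _ h oa /AD; exact: reach_step h oa.
Qed.

Lemma reach_anti w w' A v x : (forall e, w e ==> w' e) ->
  reach w' A v x -> reach w A v x.
Proof.
move=> ww'; elim; first exact: reach_refl.
move=> y z _ IH /oadjP[l [h1 h2]] zA; apply: (reach_step IH _ zA).
by apply/oadjP; exists l; split=> //; move: (ww' (ed y l)); rewrite h2; case: (w _).
Qed.

Lemma reach_agree w w' A v x : v \in A ->
  (forall e, inside A e -> w e = w' e) -> reach w A v x -> reach w' A v x.
Proof.
move=> vA ww'; elim; first exact: reach_refl.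
move=> y z ry IH /oadjP[l [<- ul]] zA; apply: (reach_step IH _ zA).
apply/oadjP; exists l; split=> //; rewrite -ww' //.
by apply/inside_ed; split=> //; exact: reach_in vA ry.
Qed.

Lemma local_reach A v x : v \in A ->
  local_on (inside A) (fun w => `[< reach w A v x >]).
Proof.
move=> vA w w' ww'; apply: asbool_equiv_eq; split; apply: reach_agree => // e /ww'.
by move=> ->.
Qed.

Definition zcluster w A v : {fset vertex d} := [fset x in A | `[< reach w A v x >]]%fset.

Lemma in_zcluster w A v x :
  x \in zcluster w A v <-> x \in A /\ reach w A v x.
Proof.
rewrite !inE /=; split; first by move=> /andP[-> /asboolP].
by move=> [-> /asboolP].
Qed.

Lemma zcluster_sub w A v : (zcluster w A v `<=` A)%fset.
Proof. by apply/fsubsetP => x /in_zcluster[]. Qed.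

Lemma zcluster_self w A v : v \in A -> v \in zcluster w A v.
Proof. by move=> vA; apply/in_zcluster; split=> //; exact: reach_refl. Qed.

Lemma local_in_zcluster A v x : v \in A ->
  local_on (inside A) (fun w => x \in zcluster w A v).
Proof. by move=> vA w w' /(local_reach x vA) h; rewrite !inE h. Qed.

Definition touching C : set (edge d) := [set e | e.1 \in C \/ tip e \in C].

Lemma touching_joins C e x y : joins e x y -> touching C e <-> x \in C \/ y \in C.
Proof.
by rewrite /joins /touching /= => /orP[]/andP[/eqP-> /eqP->]; tauto.
Qed.

Lemma touching_ed C x l : touching C (ed x l) <-> x \in C \/ nb x l \in C.
Proof. exact: touching_joins (joins_ed x l). Qed.

(** Exploring the cluster C of v reveals only the edges touching C: its inner edges
    show that C is connected to v, its boundary edges that nothing else is.  The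
    rest of the configuration therefore stays independent of the event that the
    cluster is C. *)
Lemma zcluster_explored w w' A v : v \in A ->
  (forall e, inside A e -> touching (zcluster w A v) e -> w e = w' e) ->
  zcluster w' A v = zcluster w A v.
Proof.
move=> vA ww'; apply/fsetP => x; apply/idP/idP => /in_zcluster[xA rx]; last first.
  apply/in_zcluster; split=> //; move: rx.
  elim; first exact: reach_refl.
  move=> y z ry IH /oadjP[l [<- ul]] zA; apply: (reach_step IH _ zA).
  have yA := reach_in vA ry.
  apply/oadjP; exists l; split=> //; rewrite -ww' //; first exact/inside_ed.
  by apply/touching_ed; left; exact/in_zcluster.
move: rx; elim; first exact: zcluster_self.
move=> y z ry /in_zcluster[yA ry'] /oadjP[l [<- ul]] zA.
apply/in_zcluster; split=> //; apply: (reach_step ry' _ zA).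
apply/oadjP; exists l; split=> //; rewrite ww' //; first exact/inside_ed.
by apply/touching_ed; left; exact/in_zcluster.
Qed.

Lemma local_zcluster A C v : v \in A ->
  local_on (inside A `&` touching C) (fun w => zcluster w A v == C).
Proof.
move=> vA w w' ww'; apply/eqP/eqP => CE; rewrite -{}CE in ww' *; apply: zcluster_explored => //.
  by move=> e i t; apply: ww'.
by move=> e i t; apply/esym/ww'.
Qed.

Definition cost w (g : steps d) : nat := count w (unzip1 g).

(** A shortest connection visits each vertex of A at most once, whence the bound on
    its number of steps; it has cost zero since it is open. *)
Lemma reach_steps w A v x : v \in A -> reach w A v x ->
  exists g, [/\ path_in [set` A] v g, path_end v g = x, cost w g = 0%N
    & (size g < #|` A|)%N].
Proof.
move=> vA rx.
pose r := [rel a b | oadj w a b && (b \in A)].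
have [p [rp px]] : exists p, path r v p /\ last v p = x.
  elim: rx => [|y z _ [p [rp <-]] yz zA]; first by exists [::].
  by exists (rcons p z); rewrite last_rcons rcons_path rp /= yz zA.
case/shortenP: rp px => p' rp' up' _ px.
have pA : {subset v :: p' <= A}.
  move=> y; rewrite inE => /predU1P[->//|yp].
  elim: p' v rp' yp {vA rx px up'} => //= b p' IH v /andP[/andP[_ bA]].
  by move=> rp; rewrite inE => /predU1P[->//|]; exact: IH rp.
have lt_size : (size p' < #|` A|)%N by rewrite -[(size p').+1]/(size (v :: p')); exact: uniq_leq_size.
suff [g [gp g2 g0]] : exists g : steps d, [/\ is_path v g, unzip2 g = p' & cost w g = 0%N].
  exists g; split=> //.
  - by split=> // y; rewrite g2; exact: pA.
  - by rewrite /path_end g2.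
  - by rewrite -(size_map snd g) -/(unzip2 g) g2.
elim: p' v rp' {vA rx up' px pA lt_size} => [|b p' IH] v /=; first by exists [::].
move=> /andP[/andP[/oadjP[l [<- wl]] _] /IH[g [g1 g2 g3]]].
exists ((ed v l, nb v l) :: g); split; rewrite /= ?joins_ed ?g2 //.
by rewrite /cost /= wl.
Qed.

Lemma path_in_cons (D : set (vertex d)) u e x g :
  path_in D u ((e, x) :: g) <-> [/\ D u, joins e u x & path_in D x g].
Proof.
split=> [[/= /andP[h1 h2] h3]|[h1 h2 [h3 h4]]].
  split=> //; first by apply: h3; rewrite inE eqxx.
  by split=> // y yg; apply: h3; rewrite inE yg orbT.
split; first by rewrite /= h2.
by move=> y; rewrite /= inE => /predU1P[->//|]; exact: h4.
Qed.

Lemma path_in_cat (D : set (vertex d)) u g g' :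
  path_in D u g -> path_in D (path_end u g) g' -> path_in D u (g ++ g').
Proof.
elim: g u => [|[e x] g IH] u //= /path_in_cons[h1 h2 h3] h4.
by apply/path_in_cons; split=> //; exact: IH.
Qed.

Lemma path_end_cat (u : vertex d) g g' :
  path_end u (g ++ g') = path_end (path_end u g) g'.
Proof. by rewrite /path_end /unzip2 map_cat last_cat. Qed.

Lemma path_inS (D D' : set (vertex d)) u g :
  D `<=` D' -> path_in D u g -> path_in D' u g.
Proof. by move=> DD' [h1 h2]; split=> // y /h2/DD'. Qed.

Lemma path_in_end (D : set (vertex d)) u g : path_in D u g -> D (path_end u g).
Proof. by move=> [_]; apply; rewrite /path_end mem_last. Qed.

(** Either the path ends in C, or what follows its last visit to C is a path that
    avoids C.  Looking at the last exit rather than at the first one is what makes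
    the remainder disjoint from the explored cluster. *)
Lemma last_exit w C D v g : path_in [set` D] v g -> v \in C ->
  path_end v g \in C \/
  exists x l g', [/\ x \in C, path_in [set` (D `\` C)%fset] (nb x l) g',
    path_end (nb x l) g' = path_end v g & (w (ed x l) + cost w g' <= cost w g)%N].
Proof.
pose exit v g := exists x l g', [/\ x \in C, path_in [set` (D `\` C)%fset] (nb x l) g',
    path_end (nb x l) g' = path_end v g & (w (ed x l) + cost w g' <= cost w g)%N].
suff K : path_in [set` D] v g ->
    [\/ path_in [set` (D `\` C)%fset] v g, path_end v g \in C | exit v g].
  move=> /K[[_ h]|?|?] vC; [|by left|by right].
  by move: (h v); rewrite inE eqxx /= inE vC => /(_ isT).
elim: g v => [|[e u] g IH] v.
  move=> [_ /(_ v)]; rewrite /= inE eqxx => /(_ isT) vD.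
  have [vC|vC] := boolP (v \in C); first by constructor 2.
  constructor 1; split=> // y; rewrite inE => /eqP ->.
  by rewrite /= inE vC.
move=> /path_in_cons[vD evu /IH[h|h|[x [l [g' [h1 h2 h3 h4]]]]]].
- have [vC|vC] := boolP (v \in C).
    case/joins_edP: evu => l [? ?]; subst e u.
    constructor 3; exists v, l, g; split=> //.
  constructor 1; apply/path_in_cons; split=> //=.
  by rewrite inE vC.
- by constructor 2.
- constructor 3; exists x, l, g'; split=> //.
  by apply: leq_trans h4 _; rewrite /cost /= leq_addl.
Qed.

Definition translate S v : {fset vertex d} := [fset (x + v)%R | x in S]%fset.

Lemma in_translate S v x : (x \in translate S v) = (x - v \in S).
Proof.
apply/imfsetP/idP => [[y /= yS ->]|xS]; first by rewrite addrK.
by exists (x - v) => //; rewrite subrK.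
Qed.

Lemma card_translate S v : (#|` translate S v| = #|` S|)%N.
Proof. by rewrite card_imfset //; exact: addIr. Qed.

End lattice.

(** * Cutting a path into windows *)

Section chain.
Variables (R : realType) (d : nat) (lam : R) (S : {fset vertex d}).
Notation dir := ('I_d * bool)%type.
Hypothesis S0 : 0 \in S.
Hypothesis lam01 : 0 < lam <= 1.
Implicit Types (x y v : vertex d) (e : edge d) (w : edge d -> bool).
Implicit Types (A C D : {fset vertex d}).

(** The window S is moved to v and cut down to the domain D that is still
    unexplored. *)
Definition piece D v w := zcluster w (D `&` translate S v)%fset v.

(** The sum over all ways to cross m successive windows, each crossing consisting
    of an open connection inside the window followed by one step out of the
    explored cluster.  A closed exit edge costs a factor lam, so that chains with
    few closed edges are the heavy ones; the explored cluster is deleted from the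
    domain before the next window is opened. *)
Fixpoint chain m D v w : R :=
  if m is m'.+1 then
    \sum_(x <- piece D v w) \sum_(l : dir | nb x l \in (D `\` piece D v w)%fset)
      lam ^+ w (ed x l) * chain m' (D `\` piece D v w)%fset (nb x l) w
  else 1.

Lemma chain_ge0 m D v w : 0 <= chain m D v w.
Proof.
have /andP[l0 _] := lam01.
elim: m D v => [|m IH] D v /=; first exact: ler01.
apply: sumr_ge0 => x _; apply: sumr_ge0 => l _.
by rewrite mulr_ge0 // exprn_ge0 // ltW.
Qed.

Lemma self_in_window D v : v \in D -> v \in (D `&` translate S v)%fset.
Proof. by move=> vD; rewrite inE vD in_translate subrr. Qed.

(** A path of cost k either can be replaced by one of at most m #|S| steps and no
    larger cost, or forces a heavy chain of length m.  In each window the stretch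
    up to the last exit of the cluster is replaced by an open connection of fewer
    than #|S| steps; if the target is not met within m windows, the exits used
    form a chain with at most k closed edges. *)
Lemma short_or_chain (B : set (vertex d)) m D v g w :
  path_in [set` D] v g -> B (path_end v g) ->
  (exists h, [/\ path_in [set` D] v h, B (path_end v h),
     (cost w h <= cost w g)%N & (size h <= m * #|` S|)%N]) \/
  lam ^+ cost w g <= chain m D v w.
Proof.
have /andP[l0 l1] := lam01.
elim: m D v g => [|m IH] D v g gD gB.
  by right; rewrite /= exprn_ile1 // ltW.
have vD : v \in D by case: gD => _ /(_ v); apply; rewrite inE eqxx.
have vA := self_in_window vD.
set C := piece D v w.
have CS : (#|` D `&` translate S v|%fset <= #|` S|)%N.
  by rewrite -(card_translate S v); apply/fsubset_leq_card/fsubsetIr.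
have inC x : x \in C -> exists h, [/\ path_in [set` D] v h, path_end v h = x,
    cost w h = 0%N & (size h < #|` S|)%N].
  move=> /in_zcluster[xA /(reach_steps vA)[h [h1 h2 h3 h4]]]; exists h; split=> //.
    by apply: path_inS h1 => y /=; rewrite inE => /andP[].
  exact: leq_trans CS.
have [/inC[h [h1 h2 h3 h4]]|[x [l [g' [xC g'D g'e g'c]]]]] := last_exit w gD (zcluster_self w vA).
  left; exists h; split=> //; rewrite ?h2 ?h3 //.
  by rewrite mulSn (leq_trans (ltnW h4)) // leq_addr.
have DC : [set` (D `\` C)%fset] `<=` [set` D] by move=> y /=; rewrite inE => /andP[].
have [|[h' [h'1 h'2 h'3 h'4]]|hm] := IH (D `\` C)%fset (nb x l) g' g'D.
- by rewrite g'e.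
- left; have [h [h1 h2 h3 h4]] := inC _ xC.
  exists (h ++ (ed x l, nb x l) :: h'); split.
  + apply: (path_in_cat h1); rewrite h2; apply/path_in_cons; split.
    * by rewrite -h2; exact: path_in_end h1.
    * exact: joins_ed.
    * exact: path_inS DC h'1.
  + by rewrite path_end_cat h2.
  + rewrite /cost /unzip1 map_cat count_cat -/(unzip1 h) -/(cost w h) h3 add0n /=.
    by apply: leq_trans g'c; rewrite leq_add2l.
  + by rewrite size_cat /= mulSn -addSnnS leq_add.
- have nbD : nb x l \in (D `\` C)%fset.
    by case: g'D => _ /(_ (nb x l)); apply; rewrite inE eqxx.
  right; apply: (@le_trans _ _ (lam ^+ w (ed x l) * chain m (D `\` C)%fset (nb x l) w)).
    apply: le_trans (_ : lam ^+ (w (ed x l) + cost w g') <= _).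
      by apply: ler_wiXn2l => //; exact: ltW.
    by rewrite exprD ler_wpM2l // exprn_ge0 // ltW.
  rewrite /= -/C (bigD1_seq x) ?fset_uniq //= (bigD1 l) //=.
  rewrite -addrA lerDl addr_ge0 //.
    by apply: sumr_ge0 => ? _; rewrite mulr_ge0 ?chain_ge0 // exprn_ge0 // ltW.
  apply: sumr_ge0 => ? _; apply: sumr_ge0 => ? _.
  by rewrite mulr_ge0 ?chain_ge0 // exprn_ge0 // ltW.
Qed.

End chain.

(** * Exits from a finite set *)

Section exits.
Variables (R : realType) (d : nat).
Notation dir := ('I_d * bool)%type.
Implicit Types (x y v : vertex d) (e : edge d) (w : edge d -> bool).
Implicit Types (A C D S T : {fset vertex d}) (p lam : R).

Definition exits A T v w : R :=
  \sum_(x <- zcluster w A v) \sum_(l : dir | nb x l \notin T) 1.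

Lemma ler_sum_fset (A B : {fset vertex d}) (F : vertex d -> R) :
  (A `<=` B)%fset -> (forall x, 0 <= F x) ->
  \sum_(x <- A) F x <= \sum_(x <- B) F x.
Proof.
move=> AB F0.
have -> : \sum_(x <- A) F x = \sum_(x <- A) (if x \in A then F x else 0).
  by rewrite !big_seq; apply: eq_bigr => x ->.
rewrite (big_fset_incl _ AB) => [|x _ /negbTE-> //].
by apply: ler_sum => x _; case: ifP.
Qed.

Lemma dir_sum_ge0 x T : 0 <= \sum_(l : dir | nb x l \notin T) 1 :> R.
Proof. by apply: sumr_ge0 => *; exact: ler01. Qed.

Lemma exits_mono A D T v w : v \in A -> (A `<=` D)%fset -> exits A T v w <= exits D T v w.
Proof.
move=> vA AD; apply: ler_sum_fset; last by move=> x; exact: dir_sum_ge0.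
apply/fsubsetP => x /in_zcluster[xA rx]; apply/in_zcluster; split.
  exact: (fsubsetP AD).
exact: reachS rx.
Qed.

Lemma zcluster_agree A v w w' : v \in A ->
  (forall e, inside A e -> w e = w' e) -> zcluster w A v = zcluster w' A v.
Proof. by move=> vA ww'; apply/fsetP => x; exact: local_in_zcluster ww'. Qed.

Lemma local_exits A T v : v \in A -> local_on (inside A) (exits A T v).
Proof. by move=> vA w w' ww'; rewrite /exits (zcluster_agree vA ww'). Qed.

Lemma antitone_exits A T v : antitone (exits A T v).
Proof.
move=> w w' ww'; apply: ler_sum_fset; last by move=> x; exact: dir_sum_ge0.
apply/fsubsetP => x /in_zcluster[xA rx]; apply/in_zcluster; split=> //.
exact: reach_anti rx.
Qed.

Definition shift_edge v e : edge d := (e.1 + v, e.2).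

Lemma shift_edge_inj v : injective (shift_edge v).
Proof. by move=> [x i] [y j] [/addIr -> ->]. Qed.

Lemma nb_shift x v l : nb (x + v) l = nb x l + v.
Proof. by rewrite /nb; case: ifP => _; rewrite addrAC. Qed.

Lemma ed_shift x v l : ed (x + v) l = shift_edge v (ed x l).
Proof. by rewrite /ed /shift_edge; case: ifP => _ //=; rewrite addrAC. Qed.

Lemma zcluster_shift w S v :
  zcluster w (translate S v) v = translate (zcluster (w \o shift_edge v) S 0) v.
Proof.
apply/fsetP => x; rewrite in_translate; apply/idP/idP => /in_zcluster[].
  rewrite in_translate => xS rx; apply/in_zcluster; split=> //; move: rx {xS}.
  elim; first by rewrite subrr; exact: reach_refl.
  move=> y z _ IH /oadjP[l [<- wl]]; rewrite in_translate => zS.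
  apply: (reach_step IH) zS; apply/oadjP; exists l.
  by rewrite /= -ed_shift subrK -{2}(subrK v y) (nb_shift (y - v)) addrK.
move=> xS rx; apply/in_zcluster; rewrite in_translate; split=> //.
rewrite -(subrK v x); move: (x - v) rx {xS} => u.
elim; first by rewrite add0r; exact: reach_refl.
move=> y z _ IH /oadjP[l [<- wl]] zS.
apply: (reach_step IH); last by rewrite in_translate addrK.
by apply/oadjP; exists l; rewrite nb_shift ed_shift.
Qed.

Lemma exits_shift w S v :
  exits (translate S v) (translate S v) v w = exits S S 0 (w \o shift_edge v).
Proof.
rewrite /exits zcluster_shift {1}/translate big_imfset /=; last by move=> ? ? _ _ /addIr.
apply: eq_bigr => x _; apply: eq_bigl => l.
by rewrite in_translate nb_shift addrK.
Qed.

(** p times this quantity is the function phi_p(S) of Duminil-Copin and Tassion. *)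
Definition mean_exits p S : R := mean p (inside_seq S) (exits S S 0) (fun=> false).

(** Cutting the window down to D shrinks the cluster, and the full window is a
    translate of S. *)
Lemma mean_exits_window p s D S v w : 0 <= p <= 1 -> 0 \in S -> v \in D ->
  (forall e, inside D e -> e \in s) ->
  mean p s (exits (D `&` translate S v)%fset (translate S v) v) w <= mean_exits p S.
Proof.
move=> p01 S0 vD Ds; have vA := self_in_window S0 vD.
have loc := local_exits (translate S v) vA.
have vS : v \in translate S v by rewrite in_translate subrr.
have IS e : inside (translate S v) e -> e \in map (shift_edge v) (inside_seq S).
  case: e => x i [/=]; rewrite /tip /= !in_translate => h1 h2.
  apply/mapP; exists (x - v, i); last by rewrite /shift_edge /= subrK.
  by apply/mem_inside; split=> //=; rewrite /tip /= addrAC.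
rewrite (mean_local (s' := map (shift_edge v) (inside_seq S)) p w w loc); last 2 first.
- by move=> e he; apply: Ds; apply: insideS he; exact: fsubsetIl.
- by move=> e he; apply: IS; apply: insideS he; exact: fsubsetIr.
apply: (@le_trans _ _ (mean p (map (shift_edge v) (inside_seq S))
    (exits (translate S v) (translate S v) v) w)).
  by apply: le_mean => // u; apply: exits_mono => //; exact: fsubsetIr.
have -> : exits (translate S v) (translate S v) v = fun w => exits S S 0 (w \o shift_edge v).
  by apply/funext => u; exact: exits_shift.
rewrite mean_inj; last exact: shift_edge_inj.
rewrite /mean_exits (mean_local (s' := inside_seq S) p _ (fun=> false) (local_exits S S0)) //.
  by move=> e /mem_inside.
by move=> e /mem_inside.
Qed.

End exits.

(** * Exponential decay of the mean chain weight *)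

Section mean_chain.
Variables (R : realType) (d : nat) (p lam : R) (S : {fset vertex d}).
Notation dir := ('I_d * bool)%type.
Hypothesis p01 : 0 <= p <= 1.
Hypothesis S0 : 0 \in S.
Hypothesis lam01 : 0 < lam <= 1.
Implicit Types (x y v : vertex d) (e : edge d) (w : edge d -> bool).
Implicit Types (A C D : {fset vertex d}).

Let chain := chain lam S.
Let piece := piece S.
(** Bounds the expected weight of one window crossing: exits through open edges are counted
    by phi_p(S), and each of the at most 2d #|S| other exits pays lam. *)
Definition chain_rate : R := p * mean_exits p S + lam * (#|{: dir}| * #|` S|)%:R.

Lemma local_chain m D v : v \in D -> local_on (inside D) (chain m D v).
Proof.
elim: m D v => [|m IH] D v vD w w' ww' //=.
have vA := self_in_window S0 vD.
have pE : piece D v w = piece D v w'.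
  apply: (zcluster_agree vA) => e he; apply: ww'; apply: insideS he; exact: fsubsetIl.
rewrite -/piece -pE big_seq [RHS]big_seq; apply: eq_bigr => x /in_zcluster[].
rewrite inE => /andP[xD _] _; apply: eq_bigr => l lD.
rewrite ww'; last first.
  by apply/inside_ed; split=> //; move: lD; rewrite inE => /andP[].
congr (_ * _); apply: IH => // e he; apply: ww'; apply: insideS he.
exact: fsubsetDl.
Qed.

Lemma mean_pow_edge s e w : e \in s ->
  mean p s (fun w => lam ^+ w e) w <= p + lam.
Proof.
move=> es; have loc : local_on [set e] (fun w : edge d -> bool => lam ^+ w e).
  by move=> u u' uu'; rewrite uu'.
rewrite (mean_local (s' := [:: e]) p w w loc) => [|? ->//|? ->]; last by rewrite inE eqxx.
rewrite /= /upd eqxx expr0 expr1 mulr1 lerD2l ler_piMl //.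
  by case/andP: lam01 => /ltW.
by case/andP: p01 => p0 _; rewrite gerBl.
Qed.

(** The three factors live on disjoint sets of edges: the event that the explored
    cluster is C looks at edges touching C inside the window, an exit edge of the
    window is not among them, and the rest of the chain avoids C altogether.  If the
    exit stays inside the window, its edge is closed because otherwise its endpoint
    would belong to C. *)
Lemma mean_chain_step (s : seq (edge d)) D v m w x l C (rho : R) : v \in D ->
  (forall e, inside D e -> e \in s) -> x \in C -> nb x l \in (D `\` C)%fset ->
  (C `<=` D `&` translate S v)%fset ->
  0 <= rho -> mean p s (chain m (D `\` C)%fset (nb x l)) w <= rho ->
  mean p s (fun w => (piece D v w == C)%:R *
     (lam ^+ w (ed x l) * chain m (D `\` C)%fset (nb x l) w)) w <=
  mean p s (fun w => (piece D v w == C)%:R) w *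
   ((p * (nb x l \notin translate S v)%:R + lam) * rho).
Proof.
move=> vD Ds xC nbD CA rho0 hrho; have /andP[p0 p1] := p01; have /andP[l0 l1] := lam01.
have vA := self_in_window S0 vD.
have locC : local_on (inside (D `&` translate S v)%fset `&` touching C)
    (fun w => (piece D v w == C)%:R : R).
  move=> u u' uu'; congr (nat_of_bool _)%:R; exact: (local_zcluster vA uu').
have nbDC := nbD; move: nbD; rewrite inE => /andP[nbC nbD].
have xA : x \in (D `&` translate S v)%fset := fsubsetP CA x xC.
have xD : x \in D by move: xA; rewrite inE => /andP[].
have locch : local_on (inside (D `\` C)%fset) (chain m (D `\` C)%fset (nb x l)).
  exact: local_chain.
have dis e : inside (D `\` C)%fset e -> ~ touching C e.
  by case=> h1 h2 [] h; move: h1 h2; rewrite !inE h.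
have mC : 0 <= mean p s (fun w => (piece D v w == C)%:R) w.
  by apply: mean_ge0 => // u; exact: ler0n.
have [nbS|nbS] := boolP (nb x l \in translate S v); last first.
  have loc2 : local_on [set ed x l] (fun w : edge d -> bool => lam ^+ w (ed x l)).
    by move=> u u' uu'; rewrite uu'.
  have loc3 : local_on ([set ed x l] `|` inside (D `\` C)%fset)
      (fun w => lam ^+ w (ed x l) * chain m (D `\` C)%fset (nb x l) w).
    move=> u u' uu'; congr (_ * _); first by apply: loc2 => e he; apply: uu'; left.
    by apply: locch => e he; apply: uu'; right.
  rewrite (mean_indep p s w locC loc3); last first.
    move=> e [eA eC] [/= ee|/dis//]; move: eA; rewrite ee => /inside_ed[_].
    by rewrite inE (negbTE nbS) andbF.
  rewrite (mean_indep p s w loc2 locch); last first.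
    by move=> e /= -> /dis; apply; apply/touching_ed; left.
  rewrite ler_wpM2l // mulr1 ler_pM //.
  - by apply: mean_ge0 => // u; rewrite exprn_ge0 // ltW.
  - by apply: mean_ge0 => // u; exact: chain_ge0.
  - by apply: mean_pow_edge; apply: Ds; apply/inside_ed.
rewrite mulr0 add0r.
have -> : (fun w => (piece D v w == C)%:R *
     (lam ^+ w (ed x l) * chain m (D `\` C)%fset (nb x l) w)) =
  fun w => lam * ((piece D v w == C)%:R * chain m (D `\` C)%fset (nb x l) w).
  apply/funext => u; case: eqP => [uC|]; last by rewrite !mul0r mulr0.
  suff -> : u (ed x l) = true by rewrite expr1 mul1r mul1r.
  apply/negbNE/negP => /negbTE ue; move: nbC; rewrite -uC => /negP; apply.
  have nbA : nb x l \in (D `&` translate S v)%fset by rewrite inE nbD.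
  move: xC; rewrite -uC => /in_zcluster[_ rx]; apply/in_zcluster; split=> //.
  by apply: (reach_step rx) nbA; apply/oadjP; exists l.
rewrite mean_scale (mean_indep p s w locC locch) => [|e [_ h] /dis//].
by rewrite mulrCA ler_wpM2l // ler_wpM2l // ltW.
Qed.

Lemma chain_split m D v w : chain m.+1 D v w =
  \sum_(C <- fpowerset (D `&` translate S v)%fset) \sum_(x <- C)
    \sum_(l : dir | nb x l \in (D `\` C)%fset)
    (piece D v w == C)%:R * (lam ^+ w (ed x l) * chain m (D `\` C)%fset (nb x l) w).
Proof.
rewrite (bigD1_seq (piece D v w)) ?fset_uniq //=; last first.
  by rewrite fpowersetE zcluster_sub.
rewrite [X in _ + X]big1 ?addr0 => [|C /negbTE CP]; last first.
  apply: big1 => x _; apply: big1 => l _; by rewrite eq_sym CP mul0r.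
by apply: eq_bigr => x _; apply: eq_bigr => l _; rewrite eqxx mul1r.
Qed.

Lemma mean_exit_weights s D v w : v \in D -> (forall e, inside D e -> e \in s) ->
  mean p s (fun w => \sum_(x <- piece D v w) \sum_(l : dir)
     (p * (nb x l \notin translate S v)%:R + lam)) w <= chain_rate.
Proof.
move=> vD Ds; have /andP[p0 p1] := p01; have /andP[l0 l1] := lam01.
have K u : \sum_(x <- piece D v u) \sum_(l : dir)
     (p * (nb x l \notin translate S v)%:R + lam) <=
   p * exits R (D `&` translate S v)%fset (translate S v) v u +
   lam * (#|{: dir}| * #|` S|)%:R.
  have -> : \sum_(x <- piece D v u) \sum_(l : dir)
      (p * (nb x l \notin translate S v)%:R + lam) =
    p * exits R (D `&` translate S v)%fset (translate S v) v u +
    \sum_(x <- piece D v u) \sum_(l : dir) lam.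
    rewrite /exits mulr_sumr -big_split; apply: eq_bigr => x _ /=.
    rewrite big_split; congr (_ + _); rewrite mulr_sumr [RHS]big_mkcond.
    by apply: eq_bigr => l _; case: ifP => _; rewrite ?mulr1 ?mulr0.
  rewrite lerD2l sumr_const !big_const_seq count_predT iter_addr addr0.
  rewrite -mulrnA -[lam *+ _]mulr_natr ler_wpM2l ?(ltW l0) // ler_nat leq_mul2l.
  apply/orP; right; rewrite -(card_translate S v).
  apply: fsubset_leq_card; apply: fsubset_trans (zcluster_sub _ _ _) _.
  exact: fsubsetIr.
apply: le_trans (le_mean s w p01 K) _.
rewrite mean_add mean_scale mean_cst lerD2r ler_wpM2l //.
exact: mean_exits_window.
Qed.

(** Decomposing according to the explored cluster and using independence, each
    window contributes at most a factor [chain_rate]. *)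
Lemma mean_chain s m D v w : v \in D -> (forall e, inside D e -> e \in s) ->
  mean p s (chain m D v) w <= chain_rate ^+ m.
Proof.
have /andP[p0 p1] := p01; have /andP[l0 l1] := lam01.
have r0 : 0 <= chain_rate.
  apply: addr_ge0; apply: mulr_ge0 => //; last exact: ltW.
  by apply: mean_ge0 => // u; apply: sumr_ge0 => x _; exact: dir_sum_ge0.
elim: m D v => [|m IH] D v vD Ds; first by rewrite mean_cst expr0.
have -> : chain m.+1 D v = fun w => \sum_(C <- fpowerset (D `&` translate S v)%fset)
    \sum_(x <- C) \sum_(l : dir | nb x l \in (D `\` C)%fset)
    (piece D v w == C)%:R * (lam ^+ w (ed x l) * chain m (D `\` C)%fset (nb x l) w).
  by apply/funext => u; exact: chain_split.
rewrite mean_sum exprSr.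
have := mean_exit_weights w vD Ds; set W := fun u => _ => hW.
apply: le_trans (_ : chain_rate ^+ m * mean p s W w <= _); last first.
  by rewrite ler_wpM2l // exprn_ge0.
have -> : W = fun w => \sum_(C <- fpowerset (D `&` translate S v)%fset)
    (piece D v w == C)%:R * \sum_(x <- C) \sum_(l : dir)
     (p * (nb x l \notin translate S v)%:R + lam).
  apply/funext => u; rewrite (bigD1_seq (piece D v u)) ?fset_uniq //=; last first.
    by rewrite fpowersetE zcluster_sub.
  rewrite eqxx mul1r [X in _ + X]big1 ?addr0 // => C /negbTE CP.
  by rewrite eq_sym CP mul0r.
rewrite mean_sum mulr_sumr big_seq [leRHS]big_seq; apply: ler_sum => C.
rewrite fpowersetE => CA.
rewrite mean_sum.
have -> : (fun w => (piece D v w == C)%:R * (\sum_(x <- C) \sum_(l : dir)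
     (p * (nb x l \notin translate S v)%:R + lam))) =
   fun w => (\sum_(x <- C) \sum_(l : dir)
     (p * (nb x l \notin translate S v)%:R + lam)) * (piece D v w == C)%:R.
  by apply/funext => u; rewrite mulrC.
rewrite mean_scale mulrCA mulr_suml big_seq [leRHS]big_seq; apply: ler_sum => x xC.
rewrite mean_sum mulr_suml [leRHS](bigID (fun l => nb x l \in (D `\` C)%fset)) /=.
rewrite -[leLHS]addr0 lerD //; last first.
  apply: sumr_ge0 => l _; apply: mulr_ge0.
    by rewrite addr_ge0 ?mulr_ge0 // ltW.
  by rewrite mulr_ge0 ?exprn_ge0 //; apply: mean_ge0 => // u; exact: ler0n.
apply: ler_sum => l lDC.
have step := @mean_chain_step s D v m w x l C (chain_rate ^+ m) vD Ds xC lDC CA.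
rewrite mulrA mulrC.
apply: step; rewrite ?exprn_ge0 //; apply: IH => // e he.
by apply: Ds; apply: insideS he; exact: fsubsetDl.
Qed.

End mean_chain.

(** * Sharpness of the percolation threshold *)

Section sharpness.
Variables (R : realType) (d : nat).
Notation dir := ('I_d * bool)%type.
Implicit Types (x y v : vertex d) (e : edge d) (w : edge d -> bool).
Implicit Types (A C D S T : {fset vertex d}) (p q : R).

(** Open connection to the complement of D.  Only edges with an endpoint in D are
    ever used, which makes this event local. *)
Inductive escapes w D : vertex d -> Prop :=
| escapes_out x : x \notin D -> escapes w D x
| escapes_step x y : x \in D -> oadj w x y -> escapes w D y -> escapes w D x.

Definition escapeb D w : bool := `[< escapes w D 0 >].

(** Given this set, and unlike given the cluster of the origin, the edges inside it
    are fresh. *)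
Definition trapped w D : {fset vertex d} :=
  [fset x in D | ~~ `[< escapes w D x >]]%fset.

Lemma in_trapped w D x : x \in trapped w D <-> x \in D /\ ~ escapes w D x.
Proof.
rewrite !inE /=; split; first by move=> /andP[-> /asboolPn].
by move=> [-> /asboolPn].
Qed.

Lemma trapped_sub w D : (trapped w D `<=` D)%fset.
Proof. by apply/fsubsetP => x /in_trapped[]. Qed.

Lemma escapes_anti w w' D x : (forall e, w e ==> w' e) ->
  escapes w' D x -> escapes w D x.
Proof.
move=> ww'; elim=> [y yD|y z yD /oadjP[l [h1 h2]] _ IH]; first exact: escapes_out.
apply: (escapes_step yD) IH; apply/oadjP; exists l; split=> //.
by move: (ww' (ed y l)); rewrite h2; case: (w _).
Qed.

(** The vertices outside the trapped set C see their connections without using an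
    edge inside C, and the edges leaving C towards them are closed; edges inside C
    are irrelevant to both facts. *)
Lemma trapped_explored w w' D :
  (forall e, ~ inside (trapped w D) e -> w e = w' e) ->
  forall x, escapes w D x <-> escapes w' D x.
Proof.
move=> ww' x; split.
  elim=> [y yD|y z yD yz ez IH]; first exact: escapes_out.
  apply: (escapes_step yD) IH.
  have ey : escapes w D y by exact: escapes_step ez.
  case/oadjP: yz => l [h1 h2]; apply/oadjP; exists l; split=> //.
  by rewrite -ww' // => /inside_ed[/in_trapped[]].
elim=> [y yD|y z yD /oadjP[l [h1 h2]] _ IH]; first exact: escapes_out.
apply: contrapT => ny; apply: ny; apply: (escapes_step yD) (IH).
apply/oadjP; exists l; split=> //.
by rewrite ww' // => /inside_ed[_]; rewrite h1 => /in_trapped[].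
Qed.

Lemma local_trapped D C : local_on (~` inside C) (fun w => trapped w D == C).
Proof.
have K w w' : (forall e, (~` inside C) e -> w e = w' e) ->
    trapped w D = C -> trapped w' D = C.
  move=> ww' tC; rewrite -tC in ww' *; have h := trapped_explored ww'.
  by apply/fsetP => x; apply/idP/idP => /in_trapped[h1 h2]; apply/in_trapped;
    split=> // /h.
move=> w w' ww'; apply/eqP/eqP; apply: K => // e he.
by rewrite ww'.
Qed.

(** Opening an edge from the cluster of 0 in the trapped set to a vertex outside of
    that set connects 0 to the complement of D, since that vertex already is. *)
Lemma pivotal_edge w D x l : 0 \in trapped w D ->
  x \in zcluster w (trapped w D) 0 -> nb x l \notin trapped w D ->
  escapes (upd w (ed x l) false) D 0.
Proof.
set C := trapped w D => C0 xC nC.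
have sub e : upd w (ed x l) false e ==> w e by rewrite /upd; case: eqP => //= _; exact: implybb.
have ex : escapes (upd w (ed x l) false) D x.
  move: (xC) => /in_zcluster[/in_trapped[xD _] _].
  apply: (escapes_step xD) (_ : escapes _ _ (nb x l)).
    by apply/oadjP; exists l; rewrite /upd eqxx.
  apply: escapes_anti sub _.
  have [nD|/escapes_out//] := boolP (nb x l \in D).
  by apply: contrapT => h; move/negP: nC; apply; apply/in_trapped.
move: ex sub; set w' := upd w _ _ => ex sub.
move: xC => /in_zcluster[_ rx]; elim: rx ex => // y z ry IH yz zC ez; apply: IH.
have /in_trapped[yD _] := reach_in C0 ry.
apply: (escapes_step yD) ez; case/oadjP: yz => l' [h1 h2]; apply/oadjP; exists l'; split=> //.
by move: (sub (ed y l')); rewrite h2; case: (w' _).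
Qed.

Lemma antitone_escape D : antitone (fun w => (escapeb D w)%:R : R).
Proof.
move=> w w' ww'; rewrite ler_nat; case e': (escapeb D w') => //.
suff -> : escapeb D w by [].
by apply/asboolP; apply: escapes_anti ww' _; apply/asboolP.
Qed.

Lemma influence_ge0 (f : (edge d -> bool) -> R) e w : antitone f -> 0 <= influence f e w.
Proof.
by move=> fa; rewrite subr_ge0; apply: fa => x; rewrite /upd; case: eqP => // _; exact: implybb.
Qed.

Lemma exits_le_influence s D w : uniq s -> (forall x l, x \in D -> ed x l \in s) ->
  0 \in trapped w D ->
  exits R (trapped w D) (trapped w D) 0 w <=
  \sum_(e <- s) influence (fun w => (escapeb D w)%:R) e w.
Proof.
move=> us Ds C0; set C := trapped w D.
have F0 : escapeb D w = false by apply/asboolP; case/in_trapped: C0.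
pose L := [seq (x, l) | x <- zcluster w C 0, l <- [seq l <- enum {: dir} | nb x l \notin C]].
pose E := [seq ed a.1 a.2 | a <- L].
have LP x l : (x, l) \in L -> x \in zcluster w C 0 /\ nb x l \notin C.
  move=> /allpairsPdep[y [m [yz]]]; rewrite mem_filter => /andP[ym _] [-> ->].
  by split.
have uL : uniq L.
  apply: allpairs_uniq_dep => //; first exact: fset_uniq.
    by move=> x _; rewrite filter_uniq // enum_uniq.
  by move=> [x l] [y m] _ _ /= [-> ->].
have uE : uniq E.
  rewrite map_inj_in_uniq // => -[x l] [y m] /LP[/in_zcluster[xC _] xl] /LP[/in_zcluster[yC _] ym] /=.
  exact: (ed_exit_inj xC xl yC ym).
have inE e : e \in E -> e \in s /\ influence (fun w => (escapeb D w)%:R : R) e w = 1.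
  move=> /mapP[[x l] /LP[xC xl] -> /=]; split.
    by apply: Ds; case/in_zcluster: (xC) => /in_trapped[].
  rewrite /influence.
  have -> : escapeb D (upd w (ed x l) false) by apply/asboolP; exact: pivotal_edge.
  suff -> : escapeb D (upd w (ed x l) true) = false by rewrite subr0.
  apply: contraFF F0 => /asboolP h; apply/asboolP; apply: escapes_anti h => e'.
  by rewrite /upd; case: eqP => // _; rewrite ?implybT ?implybb.
have -> : exits R C C 0 w = \sum_(e <- E) 1.
  rewrite /E big_map /L big_allpairs_dep /=; apply: eq_bigr => x _.
  by rewrite big_filter big_enum_cond.
have -> : \sum_(e <- E) 1 = \sum_(e <- s | e \in E) (1 : R).
  rewrite -[RHS]big_filter; apply/perm_big/uniq_perm; rewrite ?filter_uniq //.
  move=> e; rewrite mem_filter; apply/idP/andP => [eE|[]//].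
  by split=> //; case: (inE e eE).
rewrite [leRHS](bigID (fun e => e \in E)) /= -[leLHS]addr0 lerD //; last first.
  by apply: sumr_ge0 => e _; apply: influence_ge0; exact: antitone_escape.
by apply: ler_sum => e /inE[_ ->].
Qed.

Definition edges_from D : seq (edge d) :=
  undup [seq ed x l | x <- D, l <- enum {: dir}].

Lemma mem_edges_from D x l : x \in D -> ed x l \in edges_from D.
Proof.
move=> xD; rewrite mem_undup; apply/allpairsP; exists (x, l); split=> //.
by rewrite mem_enum.
Qed.

Lemma inside_edges_from C D e : (C `<=` D)%fset -> inside C e -> e \in edges_from D.
Proof.
move=> /fsubsetP CD [/CD eD _]; rewrite [e](_ : _ = ed e.1 (e.2, true)).
  exact: mem_edges_from.
by rewrite /ed /=; case: (e).
Qed.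

(** The percolation probability in the finite volume D. *)
Definition theta p D : R :=
  mean p (edges_from D) (fun w => (escapeb D w)%:R) (fun=> false).

(** The sum is the derivative of theta in the parameter, by Russo's formula.  When 0
    does not escape, every exit of its cluster from the trapped set C is pivotal,
    and given C the number of these exits is that of a fresh configuration inside
    C, of mean at least 1 by assumption. *)
Lemma russo_lower (x : R) D : 0 <= x <= 1 -> 0 \in D ->
  (forall C, 0 \in C -> 1 <= mean_exits x C) ->
  1 - theta x D <= \sum_(e <- edges_from D)
    mean x (edges_from D) (influence (fun w => (escapeb D w)%:R) e) (fun=> false).
Proof.
move=> x01 D0 hC; rewrite -mean_sum.
set s := edges_from D; set w0 := fun=> false.
pose g C w : R := (trapped w D == C)%:R.
have sumg (h : {fset vertex d} -> R) w :
    \sum_(C <- fpowerset D) g C w * h C = h (trapped w D).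
  rewrite (bigD1_seq (trapped w D)) ?fset_uniq ?fpowersetE ?trapped_sub //=.
  rewrite /g eqxx mul1r big1 ?addr0 // => C /negbTE CP.
  by rewrite eq_sym CP mul0r.
have lower w : \sum_(C <- fpowerset D) (0 \in C)%:R * (g C w * exits R C C 0 w) <=
    \sum_(e <- s) influence (fun w => (escapeb D w)%:R) e w.
  have -> : \sum_(C <- fpowerset D) (0 \in C)%:R * (g C w * exits R C C 0 w) =
    \sum_(C <- fpowerset D) g C w * ((0 \in C)%:R * exits R C C 0 w).
    by apply: eq_bigr => C _; rewrite mulrCA.
  rewrite sumg; case: (boolP (0 \in trapped w D)) => C0; last first.
    rewrite mul0r; apply: sumr_ge0 => e _; apply: influence_ge0; exact: antitone_escape.
  rewrite mul1r; apply: exits_le_influence => //; first exact: undup_uniq.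
  exact: mem_edges_from.
apply: le_trans (le_mean s w0 x01 lower); rewrite mean_sum.
have -> : 1 - theta x D = mean x s (fun w => \sum_(C <- fpowerset D) (0 \in C)%:R * g C w) w0.
  have -> : (fun w => \sum_(C <- fpowerset D) (0 \in C)%:R * g C w) =
      fun w => 1 + (-1) * (escapeb D w)%:R.
    apply/funext => w.
    rewrite (eq_bigr (fun C => g C w * (0 \in C)%:R)) => [|C _]; last by rewrite mulrC.
    rewrite (sumg (fun C => (0 \in C)%:R)).
    have -> : (0 \in trapped w D) = ~~ escapeb D w.
      by apply/idP/idP => [/in_trapped[_ /asboolPn]//|/asboolPn h]; apply/in_trapped.
    by case: (escapeb D w) => /=; ring.
  by rewrite mean_add mean_cst mean_scale mulN1r.
rewrite mean_sum big_seq [leRHS]big_seq; apply: ler_sum => C; rewrite fpowersetE => CD.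
rewrite !mean_scale; case: (boolP (0 \in C)) => C0; last by rewrite !mul0r.
rewrite !mul1r.
have loc1 : local_on (~` inside C) (g C).
  by move=> w w' ww'; rewrite /g (local_trapped D ww').
rewrite (mean_indep x s w0 loc1 (local_exits R C C0)) //.
rewrite (mean_local (s' := inside_seq C) x w0 w0 (local_exits R C C0)) => [|e he|e /mem_inside//].
  by rewrite ler_peMr ?hC //; apply: mean_ge0 => // w; exact: ler0n.
exact: inside_edges_from he.
Qed.

(** The argument of Duminil-Copin and Tassion: if p * mean_exits p S were at
    least 1 for every S containing 0, then mean_exits x S would be at least 1 for all
    x in [p, q] and theta would have derivative at least 1 - theta there; this keeps
    theta q D away from 0 uniformly in D. *)
Lemma subcritical_set p q : 0 <= p -> p < q -> q <= 1 ->
  (forall eps : R, 0 < eps -> exists D, 0 \in D /\ theta q D < eps) ->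
  exists S, 0 \in S /\ p * mean_exits p S < 1.
Proof.
move=> p0 pq q1 hq; apply: contrapT => hS.
have ge1 S : 0 \in S -> 1 <= p * mean_exits p S.
  by move=> S0; rewrite leNgt; apply/negP => h; apply: hS; exists S.
have p1 : p <= 1 := le_trans (ltW pq) q1.
have ge1x (x : R) S : p <= x -> x <= 1 -> 0 \in S -> 1 <= mean_exits x S.
  move=> px x1 /[dup] S0 /ge1 h; apply: le_trans h _.
  apply: le_trans (_ : mean_exits p S <= _).
    rewrite ler_piMl //; apply: mean_ge0; first by rewrite p0.
    by move=> w; apply: sumr_ge0 => y _; exact: dir_sum_ge0.
  by apply: mean_monotone => //; exact: antitone_exits.
(* eps <= 1 / 2 keeps theta below 1 / 2, hence its slope above 1 / 2, on [p, q];
   theta then grows by at least (q - p) / 2 >= eps, contradicting theta q D < eps *)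
pose eps : R := Num.min (2^-1) ((q - p) / 2).
have eps0 : 0 < eps by rewrite lt_min invr_gt0 ltr0n divr_gt0 ?subr_gt0.
have [D [D0]] := hq _ eps0; rewrite lt_min => /andP[hD1 hD2].
have der (x : R) : is_derive x (1 : R) (theta^~ D)
   (\sum_(e <- edges_from D)
    mean x (edges_from D) (influence (fun w => (escapeb D w)%:R) e) (fun=> false)).
  by apply: is_derive_mean; exact: undup_uniq.
have [|c /andP[pc cq] fE] := MVT pq (fun (x : R) _ => der x).
  apply: derivable_within_continuous => x _; exact: ex_derive.
rewrite !bnd_simp in pc cq.
have c1 : c <= 1 := ltW (lt_le_trans cq q1).
have c0 : 0 <= c := le_trans p0 (ltW pc).
have low := @russo_lower c D _ D0 (fun C => ge1x c C (ltW pc) c1).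
have {}low := low ltac:(by rewrite c0).
have cq' : theta c D <= theta q D.
  by apply: mean_monotone => //; [exact: ltW|exact: antitone_escape].
have p0' : 0 <= theta p D by apply: mean_ge0 => [|w]; rewrite ?p0 // ler0n.
move: fE low; set df := \sum_(_ <- _) _ => fE low.
have : 2^-1 * (q - p) <= df * (q - p).
  rewrite ler_wpM2r ?subr_ge0 ?(ltW pq) //; lra.
lra.
Qed.

End sharpness.

(** * The product measure on local events *)

Section product.
Variables (R : realType) (d : nat) (p : R) (P : probability (config d) R).
Hypothesis Pp : is_product_measure p P.
Implicit Types (s : seq (edge d)) (b w : edge d -> bool) (B : (edge d -> bool) -> bool).

Definition cylinder s b : set (config d) := [set w | forall e, e \in s -> w e = b e].

Lemma cylinder_cons e s b :
  cylinder (e :: s) b = [set w : config d | w e = b e] `&` cylinder s b.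
Proof.
apply/seteqP; split=> [w h|w [h1 h2] f].
  by split=> [|f fs] /=; apply: h; rewrite inE ?eqxx // fs orbT.
by rewrite inE => /predU1P[->//|]; exact: h2.
Qed.

Lemma measurable_cylinder s b : measurable (cylinder s b).
Proof.
elim: s => [|e s IH].
  by rewrite (_ : cylinder [::] b = setT) //; apply/seteqP; split.
rewrite cylinder_cons; apply: measurableI => //.
by apply: sub_sigma_algebra; exists e, (b e).
Qed.

Lemma cylinder_split e s b : e \notin s ->
  cylinder s b =
    cylinder (e :: s) (upd b e false) `|` cylinder (e :: s) (upd b e true).
Proof.
move=> es; apply/seteqP; split=> w.
  move=> h; have K c : w e = c -> cylinder (e :: s) (upd b e c) w.
    move=> wc f; rewrite inE /upd; case: eqP => [->//|_ /= fs]; exact: h.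
  by case we: (w e); [right|left]; exact: K.
have K c : cylinder (e :: s) (upd b e c) w -> cylinder s b w.
  move=> h f fs; rewrite h ?inE ?fs ?orbT // /upd; case: eqP => // fe.
  by move: es; rewrite -fe fs.
by case=> /K.
Qed.

Lemma prob_cylinder_cons e s b c : uniq (e :: s) ->
  P (cylinder (e :: s) (upd b e c)) =
  ((if c then 1 - p else p)%:E * P (cylinder s b))%E.
Proof.
move=> /[dup] u /= /andP[es us].
rewrite /cylinder Pp // Pp // big_cons -EFinM /upd eqxx; congr ((_ * _)%:E).
rewrite big_seq [RHS]big_seq; apply: eq_bigr => f fs; case: eqP => // fe.
by move: es; rewrite -fe fs.
Qed.

(** Conditioning on one more coordinate at a time; once all of them are fixed the
    event is empty or the whole cylinder. *)
Lemma prob_local_cylinder B s s' b : uniq (s' ++ s) ->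
  local_on [set e | e \in s' ++ s] B ->
  measurable ([set w : config d | B w] `&` cylinder s' b) /\
  P ([set w : config d | B w] `&` cylinder s' b) =
    ((mean p s (fun w => (B w)%:R) b)%:E * P (cylinder s' b))%E.
Proof.
elim: s s' b => [|e s IH] s' b.
  rewrite cats0 => us Bs.
  have -> : [set w : config d | B w] `&` cylinder s' b =
      if B b then cylinder s' b else set0.
    have K w : cylinder s' b w -> B w = B b by move=> h; apply: Bs => f; exact: h.
    apply/seteqP; split=> [w [/= Bw h]|w]; first by rewrite -(K w h) Bw.
    by case: ifP => // Bb h; split=> //=; rewrite (K w h).
  rewrite /=; case: (B b); first by rewrite mul1e; split=> //; exact: measurable_cylinder.
  by rewrite measure0 mul0e; split.
move=> us Bs.
have us' : uniq ((e :: s') ++ s).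
  by rewrite -[_ ++ s]/([:: e] ++ s' ++ s) uniq_catCA.
have Bs' : local_on [set f | f \in (e :: s') ++ s] B.
  apply: local_onS Bs => f /=; rewrite !(inE, mem_cat) => /orP[->|/orP[->|->]];
  by rewrite ?orbT.
have es' : e \notin s' by move: us' => /= /andP[]; rewrite mem_cat negb_or => /andP[].
have ues' : uniq (e :: s') by move: us'; rewrite cat_uniq => /and3P[].
have [m0 P0] := IH (e :: s') (upd b e false) us' Bs'.
have [m1 P1] := IH (e :: s') (upd b e true) us' Bs'.
rewrite (cylinder_split b es') setIUr; split; first exact: measurableU.
rewrite -(cylinder_split b es').
transitivity (P ([set w | B w] `&` cylinder (e :: s') (upd b e false)) +
    P ([set w | B w] `&` cylinder (e :: s') (upd b e true)))%E.
  apply: measureU => //; apply/seteqP; split=> // w [[_ h0] [_ h1]].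
  by have := h0 e; have := h1 e; rewrite inE eqxx /upd eqxx => -> // /(_ isT).
rewrite P0 P1 !prob_cylinder_cons //= !muleA -!EFinM -muleDl //=; last first.
  by rewrite Pp //; case/andP: ues'.
by rewrite -EFinD; congr (_%:E * _)%E; ring.
Qed.

Lemma prob_local B s w : uniq s -> local_on [set e | e \in s] B ->
  measurable [set w : config d | B w] /\
  P [set w : config d | B w] = (mean p s (fun w => (B w)%:R) w)%:E.
Proof.
move=> us Bs; have := @prob_local_cylinder B s [::] w us Bs.
have -> : cylinder [::] w = setT by apply/seteqP; split.
by rewrite setIT probability_setT mule1.
Qed.

End product.

(** Events that depend on finitely many edges form a generating pi-system on which
    the measure is prescribed. *)
Lemma is_product_measure_unique (R : realType) (d : nat) (p : R)
    (P P' : probability (config d) R) :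
  is_product_measure p P -> is_product_measure p P' ->
  forall A, measurable A -> P A = P' A.
Proof.
move=> Pp P'p.
pose G : set (set (config d)) := [set A |
  exists (B : (edge d -> bool) -> bool) (s : seq (edge d)), [/\ uniq s,
  local_on [set e : edge d | e \in s] B & A = [set w | B w]]].
have Gm A : G A -> measurable A.
  by move=> [B [s [us Bs ->]]]; case: (prob_local Pp (fun=> false) us Bs).
have GP A : G A -> P A = P' A.
  move=> [B [s [us Bs ->]]].
  by rewrite (prob_local Pp (fun=> false) us Bs).2 (prob_local P'p (fun=> false) us Bs).2.
have GT : G setT.
  by exists (fun=> true), [::]; split=> //; apply/seteqP; split.
apply: (@measure_unique _ _ _ G (fun=> setT)) => //.
- apply/seteqP; split; last by apply: smallest_sub => //; exact: sigma_algebra_measurable.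
  apply: smallest_sub => [|_ [e [b ->]]]; first exact: smallest_sigma_algebra.
  apply: sub_gen_smallest; exists (fun w => w e == b), [:: e]; split=> //.
    by move=> w w' ww'; rewrite ww' //= inE.
  by apply/seteqP; split=> w /eqP.
- move=> _ _ [B [s [us Bs ->]]] [B' [s' [us' Bs' ->]]].
  exists (fun w => B w && B' w), (undup (s ++ s')); split.
  + exact: undup_uniq.
  + move=> w w' ww'; rewrite (Bs w w') ?(Bs' w w') // => e es; apply: ww'.
      by rewrite /= mem_undup mem_cat es orbT.
    by rewrite /= mem_undup mem_cat es.
  + by apply/seteqP; split=> w /andP.
- by rewrite bigcup_const.
- by move=> _; exact: le_lt_trans (probability_le1 P measurableT) (ltry 1).
Qed.

(** * From the critical probability to a finite criterion *)

Section percolation.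
Variables (R : realType) (d : nat).
Implicit Types (w : edge d -> bool) (D : {fset vertex d}).

(** An exhaustion of the lattice by finite sets; their shape is immaterial, so an
    enumeration of the vertices is used. *)
Definition ball_fset n : {fset vertex d} :=
  [fset x in pmap (@choice.unpickle (vertex d)) (iota 0 n)]%fset.

Lemma in_ball_fset n (x : vertex d) : (choice.pickle x < n)%N -> x \in ball_fset n.
Proof.
move=> xn; rewrite !inE /= mem_pmap; apply/mapP; exists (choice.pickle x).
  by rewrite mem_iota.
by rewrite choice.pickleK.
Qed.

Lemma sub_ball_fset m n : (m <= n)%N -> (ball_fset m `<=` ball_fset n)%fset.
Proof.
move=> mn; apply/fsubsetP => x; rewrite !inE /= !mem_pmap => /mapP[k].
rewrite mem_iota add0n => /andP[_ km] xk; apply/mapP; exists k => //.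
by rewrite mem_iota add0n (leq_trans km).
Qed.

Lemma fset_sub_ball (A : {fset vertex d}) : exists n, (A `<=` ball_fset n)%fset.
Proof.
exists (\max_(x <- A) (choice.pickle x)).+1; apply/fsubsetP => x xA; apply: in_ball_fset.
by rewrite ltnS; exact: leq_bigmax_seq.
Qed.

Lemma escapes_path w D (x : vertex d) : escapes w D x <->
  exists g, [/\ is_path x g, path_end x g \notin D & forall e, e \in unzip1 g -> w e = false].
Proof.
split.
  elim=> [y yD|y z yD /oadjP[l [<- wl]] _ [g [g1 g2 g3]]]; first by exists [::].
  exists ((ed y l, nb y l) :: g); split=> //=; first by rewrite joins_ed.
  by move=> e; rewrite inE => /predU1P[->//|]; exact: g3.
move=> [g [g1 g2 g3]]; elim: g x g1 g2 g3 => [|[e y] g IH] x; first by move=> _ xD _; exact: escapes_out.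
move=> /= /andP[jx gy] gD g3; case/joins_edP: jx => l [? ?]; subst e y.
have [xD|xD] := boolP (x \in D); last exact: escapes_out.
apply: (escapes_step xD) (IH _ gy gD _) => [|e eg].
  by apply/oadjP; exists l; split=> //; apply: g3; rewrite inE eqxx.
by apply: g3; rewrite inE eg orbT.
Qed.

Lemma escapes_sub w D D' (x : vertex d) : (D `<=` D')%fset -> escapes w D' x -> escapes w D x.
Proof.
move=> /fsubsetP DD' /escapes_path[g [g1 g2 g3]]; apply/escapes_path; exists g; split=> //.
by apply: contra g2 => /DD'.
Qed.

Lemma local_escape D : local_on [set e | e \in edges_from D] (escapeb D).
Proof.
have K w w' (x : vertex d) : (forall e, e \in edges_from D -> w e = w' e) ->
    escapes w D x -> escapes w' D x.
  move=> ww'; elim=> [y yD|y z yD /oadjP[l [h1 h2]] _ IH]; first exact: escapes_out.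
  apply: (escapes_step yD) IH; apply/oadjP; exists l; split=> //.
  by rewrite -ww' // mem_edges_from.
by move=> w w' ww'; apply: asbool_equiv_eq; split; apply: K => // e he; rewrite ww'.
Qed.

Lemma infinite_cluster_escapes w : infinite_set (open_cluster w) <->
  forall D, escapes w D 0.
Proof.
split=> [iw D|h /finite_fsetP[A wA]].
  have [v [[g [g1 g2 g3]] vD]] : exists v, open_cluster w v /\ v \notin D.
    apply: contrapT => /forallNP h; apply: iw; apply: (sub_finite_set _ (finite_fset D)).
    by move=> v wv; apply: contrapT => /negP vD; apply: (h v).
  by apply/escapes_path; exists g; rewrite g2.
have /escapes_path[g [g1 g2 g3]] := h A; move/negP: g2; apply.
have : open_cluster w (path_end 0 g) by exists g.
by rewrite wA.
Qed.

(** The events that 0 escapes from larger and larger finite sets decrease to the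
    event of an infinite cluster. *)
Lemma theta_small (q : R) (P : probability (config d) R) :
  is_product_measure q P -> P [set w : config d | infinite_set (open_cluster w)] = 0%E ->
  forall eps : R, 0 < eps -> exists D, 0 \in D /\ theta q D < eps.
Proof.
move=> Pq P0 eps eps0.
pose D n := ball_fset (n + (choice.pickle (0 : vertex d)).+1).
pose F n : set (config d) := [set w | escapeb (D n) w].
have pF n := prob_local Pq (fun=> false) (undup_uniq _) (@local_escape (D n)).
have FE : \bigcap_n F n = [set w | infinite_set (open_cluster w)].
  apply/seteqP; split=> w.
    move=> h; apply/infinite_cluster_escapes => A.
    have [n An] := fset_sub_ball A.
    apply: escapes_sub (_ : escapes w (D n) 0); last by apply/asboolP; exact: h.
    by apply: (fsubset_trans An); apply: sub_ball_fset; exact: leq_addr.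
  by move=> /infinite_cluster_escapes h n _; apply/asboolP.
have mF n : measurable (F n) by case: (pF n).
have : P (F n) @[n --> \oo] --> P (\bigcap_n F n).
  apply: nonincreasing_cvg_mu => //.
  - exact: le_lt_trans (probability_le1 P (mF _)) (ltry 1).
  - exact: bigcapT_measurable.
  - move=> m n mn; apply/subsetPset => w /asboolP h; apply/asboolP.
    by apply: escapes_sub h; apply: sub_ball_fset; rewrite leq_add2r.
rewrite FE P0 => /fine_cvg /cvgr0Pnorm_lt /(_ _ eps0)[N _ /(_ N (leqnn N))] /=.
rewrite (_ : P (F N) = (theta q (D N))%:E) /= => [h|]; last exact: (pF N).2.
exists (D N); split.
  by apply: in_ball_fset; rewrite -addSnnS ltnS leq_addl.
exact: le_lt_trans (ler_norm _) h.
Qed.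

(** Some q > p has no infinite cluster, so that [subcritical_set] applies. *)
Lemma critical_set (p : R) : 0 < p < critical_probability R d ->
  p < 1 /\ exists S : {fset vertex d}, 0 \in S /\ p * mean_exits p S < 1.
Proof.
move=> /andP[p0 pc].
have [q [[/andP[q0 q1] [P [Pq P0]]] pq]] : exists q, [set q : R | 0 <= q <= 1 /\
    exists P : probability (config d) R, is_product_measure q P /\
      P [set w : config d | infinite_set (open_cluster w)] = 0%E] q /\ p < q.
  apply: contrapT => /forallNP h; move: pc; apply/negP; rewrite -leNgt.
  rewrite /critical_probability; set E := mkset _ in h *.
  have [->|/set0P E0] := eqVneq E set0; first by rewrite sup0 ltW.
  apply: ge_sup => // q Eq; rewrite leNgt; apply/negP => pq; exact: (h q).
split; first exact: lt_le_trans q1.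
by apply: (subcritical_set (q := q)) => //; [exact: ltW|exact: theta_small P0].
Qed.

End percolation.

(** * Passage times along a coordinate axis *)

Section axis.
Variables (R : realType) (d : nat) (i0 : 'I_d).
Implicit Types (w : config d) (u v : vertex d) (g : steps d) (s : R).

Lemma path_time_cost w g : path_time R w g = (cost w g)%:R.
Proof.
rewrite /path_time /cost; elim: (unzip1 g) => [|e r IH] /=; first by rewrite big_nil.
by rewrite big_cons IH natrD.
Qed.

Lemma path_time_ge0 w g : 0 <= path_time R w g.
Proof. by rewrite path_time_cost. Qed.

Lemma inf_times_le w (A : set (steps d)) g : A g ->
  inf [set path_time R w g | g in A] <= path_time R w g.
Proof.
move=> Ag; apply: ge_inf; last by exists g.
by exists 0 => _ [h _ <-]; exact: path_time_ge0.
Qed.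

Lemma inf_times_ge0 w (A : set (steps d)) : 0 <= inf [set path_time R w g | g in A].
Proof.
have [->|/set0P[g Ag]] := eqVneq A set0; first by rewrite image_set0 inf0.
apply: lb_le_inf; first by exists (path_time R w g), g.
by move=> _ [h _ <-]; exact: path_time_ge0.
Qed.

Lemma vertex_time_nb w u v l : (exists g, is_path u g /\ path_end u g = v) ->
  vertex_time R w u (nb v l) <= vertex_time R w u v + 1.
Proof.
move=> [g0 [g01 g02]]; rewrite -lerBlDr; apply: lb_le_inf.
  by exists (path_time R w g0), g0.
move=> _ [g [gp gv] <-]; rewrite lerBlDr.
pose g' := g ++ [:: (ed v l, nb v l)].
have g'p : is_path u g' /\ path_end u g' = nb v l.
  rewrite path_end_cat; split=> //; rewrite /g'.
  elim: g u gp gv {g0 g01 g02 g'} => [|[e x] g IH] u /=.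
    by move=> _ <-; rewrite /path_end /= joins_ed.
  by move=> /andP[-> /IH].
apply: le_trans (inf_times_le w (A := [set g | is_path u g /\ path_end u g = nb v l]) g'p) _.
rewrite !path_time_cost natr1 ler_nat /g' /cost /unzip1 map_cat count_cat /=.
by rewrite -addn1 leq_add2l addn0; case: (w _).
Qed.

Definition axis k : vertex d := unitv i0 *+ k.

Lemma nb_axis k : nb (axis k) (i0, true) = axis k.+1.
Proof. by rewrite /nb /axis mulrSr. Qed.

Lemma nb_axisN k : nb (axis k.+1) (i0, false) = axis k.
Proof. by rewrite /nb /axis mulrSr addrK. Qed.

Lemma axis_path (D : set (vertex d)) k : (forall j, (j <= k)%N -> D (axis j)) ->
  exists g, [/\ path_in D 0 g, path_end 0 g = axis k & size g = k].
Proof.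
elim: k => [|k IH] kD.
  exists [::]; split=> //; split=> // v; rewrite inE => /eqP ->.
  exact: (kD 0%N).
have [|g [g1 g2 g3]] := IH; first by move=> j jk; apply: kD; exact: leqW.
exists (g ++ [:: (ed (axis k) (i0, true), axis k.+1)]); split.
- apply: path_in_cat => //; rewrite g2; apply/path_in_cons; split.
  + exact: kD.
  + by rewrite -nb_axis joins_ed.
  + by split=> // v; rewrite inE => /eqP ->; exact: kD.
- by rewrite path_end_cat.
- by rewrite size_cat g3 addn1.
Qed.

Definition axis_time w k : R := vertex_time R w 0 (axis k).

Lemma axis_time_lipschitz w m n :
  `|axis_time w m - axis_time w n| <= `|m%:R - n%:R|.
Proof.
have ex k : exists g : steps d, is_path 0 g /\ path_end 0 g = axis k.
  by have [//|g [[g1 _] g2 _]] := @axis_path setT k; exists g.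
have K k j : `|axis_time w (k + j) - axis_time w k| <= j%:R.
  elim: j => [|j IH]; first by rewrite addn0 subrr normr0.
  have h1 := vertex_time_nb w (i0, true) (ex (k + j)%N).
  have h2 := vertex_time_nb w (i0, false) (ex (k + j).+1).
  rewrite nb_axis in h1; rewrite nb_axisN in h2.
  rewrite addnS -natr1 -[axis_time w (k + j).+1](subrK (axis_time w (k + j))) -addrA.
  rewrite addrC (le_trans (ler_normD _ _)) // lerD // ler_norml /axis_time; lra.
have [mn|/ltnW nm] := leqP m n.
  by rewrite distrC [leRHS]distrC -(subnKC mn) natrD (addrC m%:R) addrK [leRHS]ger0_norm.
by rewrite -(subnKC nm) natrD (addrC n%:R) addrK [leRHS]ger0_norm.
Qed.

Lemma axis_time0 w : axis_time w 0 = 0.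
Proof.
apply/eqP; rewrite eq_le inf_times_ge0 andbT.
have := @inf_times_le w [set g | is_path 0 g /\ path_end 0 g = axis 0] [::].
by rewrite path_time_cost; apply.
Qed.

(** The position on the axis of the vertex nearest to the point n s. *)
Definition site s n : nat := Num.truncn (n%:R * s + 2^-1).

Lemma site_near s n : 0 <= s -> `|(site s n)%:R - n%:R * s| <= 1.
Proof.
move=> s0; have h : 0 <= n%:R * s + 2^-1 by rewrite addr_ge0 ?mulr_ge0.
have := truncn_itv h; rewrite -/(site s n) -[(site s n).+1%:R]natr1 ler_norml => /andP[h1 h2].
by apply/andP; split; lra.
Qed.

Definition axisR : 'rV[R]_d := delta_mx 0 i0.

Lemma map_axis k : map_mx intr (axis k) = k%:R *: axisR :> 'rV[R]_d.
Proof.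
apply/rowP => j; rewrite !mxE mulmxnE !mxE; case: (_ && _).
  by rewrite /= !mulr1n mulrz_nat mulr1.
by rewrite mul0rn mulr0.
Qed.

Lemma point_time_axis w s n : 0 <= s ->
  point_time w 0 (n%:R *: (s *: axisR)) = axis_time w (site s n).
Proof.
move=> s0; rewrite /point_time /axis_time; congr vertex_time.
  apply/rowP => j; rewrite !mxE add0r; apply/eqP.
  by rewrite floor_eq // ; lra.
apply/rowP => j; rewrite !mxE mulmxnE !mxE; case: (_ && _) => /=.
  have h : 0 <= n%:R * s + 2^-1 by rewrite addr_ge0 ?mulr_ge0.
  rewrite !mulr1 [RHS]natz /site truncn_floor h /=.
  by rewrite gez0_abs // floor_ge0.
by rewrite !mulr0 add0r mul0rn; apply/eqP; rewrite floor_eq //; lra.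
Qed.

Lemma cvg_inv_nat : (fun n : nat => n%:R^-1 : R) @ \oo --> (0 : R).
Proof.
rewrite -(@cvg_shiftS R); exact: cvg_harmonic.
Qed.

(** The times for the two speeds are compared at the indices n and n s' / s rounded
    down, where the two sites differ by at most s + 2; passage times along the axis
    are 1-Lipschitz, so the difference disappears after division by n. *)
Lemma scale_axis_limit w s s' (m : R) : 0 < s -> 0 < s' ->
  (fun n : nat => n%:R^-1 * axis_time w (site s n)) @ \oo --> m ->
  (fun n : nat => n%:R^-1 * axis_time w (site s' n)) @ \oo --> m * (s' / s).
Proof.
move=> s0 s'0 hm; pose c := s' / s; have c0 : 0 < c by rewrite divr_gt0.
(* at speed s, the index k n reaches the same point as n at speed s' *)
pose k n := Num.truncn (n%:R * c).
have kP n : (k n)%:R <= n%:R * c < (k n)%:R + 1.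
  by rewrite natr1; apply: truncn_itv; rewrite mulr_ge0 // ltW.
have H1 : (fun n : nat => (k n)%:R / n%:R) @ \oo --> c.
  apply: (@squeeze_cvgr _ _ _ _ (fun n : nat => c - n%:R^-1) (fun=> c)).
  - exists 1%N => // n /= n1; have /andP[h1 h2] := kP n.
    have n0 : 0 < n%:R :> R by rewrite ltr0n.
    rewrite ler_pdivrMr // [c * _]mulrC h1 andbT ler_pdivlMr // mulrBl mulVf ?gt_eqF //.
    by rewrite mulrC lerBlDr ltW.
  - rewrite -[X in _ --> X]subr0; apply: cvgB; first exact: cvg_cst.
    exact: cvg_inv_nat.
  - exact: cvg_cst.
have H2 : (fun n : nat => (k n)%:R^-1 * axis_time w (site s (k n))) @ \oo --> m.
  apply: (cvg_comp k (fun n : nat => n%:R^-1 * axis_time w (site s n)) _ hm).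
  apply/cvgnyPge => A; have := nbhs_infty_gtr (A%:R / c).
  apply: filterS => n; rewrite ltr_pdivrMr // => h.
  by rewrite truncn_ge_nat ?(ltW h) // mulr_ge0 // ltW.
have bound : (fun n : nat => n%:R^-1 * (s + 2)) @ \oo --> (0 : R).
  by rewrite -[X in _ --> X](mul0r (s + 2)); apply: cvgM; [exact: cvg_inv_nat|exact: cvg_cst].
have H3 : (fun n : nat => n%:R^-1 * (axis_time w (site s' n) - axis_time w (site s (k n))))
    @ \oo --> (0 : R).
  apply: (@squeeze_cvgr _ _ _ _ (fun n : nat => - (n%:R^-1 * (s + 2)))
    (fun n : nat => n%:R^-1 * (s + 2))).
  - apply: nearW => n; rewrite -ler_norml normrM (@ger0_norm _ n%:R^-1) ?invr_ge0 //.
    rewrite ler_wpM2l ?invr_ge0 //; apply: le_trans (axis_time_lipschitz _ _ _) _.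
    have h1 := site_near n (ltW s'0); have h2 := site_near (k n) (ltW s0).
    have /andP[h3 h4] := kP n.
    have h3' : (k n)%:R * s <= n%:R * s'.
      have := ler_wpM2r (ltW s0) h3; rewrite -mulrA divfK ?gt_eqF //.
    have h4' : n%:R * s' <= (k n)%:R * s + s.
      by have := ler_wpM2r (ltW s0) (ltW h4); rewrite -mulrA divfK ?gt_eqF // mulrDl mul1r.
    move: h1 h2; rewrite !ler_norml; lra.
  - by rewrite -[X in _ --> X]oppr0; exact: cvgN.
  - exact: bound.
have -> : m * (s' / s) = 0 + c * m by rewrite add0r mulrC.
apply: cvg_trans (cvgD H3 (cvgM H1 H2)); apply: near_eq_cvg.
exists 1%N => // n /= n1; have n0 : n%:R != 0 :> R by rewrite pnatr_eq0 -lt0n.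
suff -> : n%:R^-1 * axis_time w (site s' n) =
    n%:R^-1 * (axis_time w (site s' n) - axis_time w (site s (k n))) +
    (k n)%:R / n%:R * ((k n)%:R^-1 * axis_time w (site s (k n))) by [].
have [k0|k0] := eqVneq (k n) 0%N.
  rewrite k0 !mul0r addr0.
  have -> : site s 0 = 0%N by rewrite /site mul0r add0r; apply: truncn_def; lra.
  by rewrite axis_time0 subr0.
have kn0 : (k n)%:R != 0 :> R by rewrite pnatr_eq0.
by field; rewrite n0 kn0.
Qed.

Variable P : probability (config d) R.

(** Outside the limit ball the time constant exceeds 1, hence is not the default
    value 0 and is a true almost sure limit; the limits at all other points of the
    axis follow by scaling. *)
Lemma time_constant_axis s s0 : 0 < s0 -> 0 < s ->
  ~ limit_ball P (s0 *: axisR) -> 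
  time_constant P (s *: axisR) = time_constant P (s0 *: axisR) * (s / s0).
Proof.
move=> s00 ss0; rewrite /limit_ball /= => /negP; rewrite -ltNge.
pose L s := [set m : R | {ae P, forall w : config d,
    (fun n : nat => n%:R^-1 * point_time w 0 (n%:R *: (s *: axisR))) @ \oo --> m}].
rewrite /time_constant -/(L s) -/(L s0).
case: xgetP => [m _ Lm|]; last by rewrite ltr10.
move=> _.
have Ls : L s (m * (s / s0)).
  move: Lm; apply: filterS => w.
  have E r : 0 <= r -> (fun n : nat => n%:R^-1 * point_time w 0 (n%:R *: (r *: axisR))) =
      fun n : nat => n%:R^-1 * axis_time w (site r n).
    by move=> r0; apply/funext => n; rewrite point_time_axis.
  rewrite !E ?ltW //; exact: scale_axis_limit.
have pf : ProperFilter (almost_everywhere P).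
  apply: ae_properfilter_algebraOfSetsType.
  exact: (eq_ind_r (fun x => (0 < x)%E) lte01 (probability_setT P)).
case: xgetP => [m' _ Lm'|/(_ _ Ls)//].
have [w [h1 h2]] := filter_ex (filterI Ls Lm').
exact: cvg_unique h2 h1.
Qed.

Lemma limit_ball_axis s s0 : 0 < s0 -> s0 <= s ->
  ~ limit_ball P (s0 *: axisR) -> ~ limit_ball P (s *: axisR).
Proof.
move=> s00 ss /[dup] h; have s0' := lt_le_trans s00 ss.
rewrite /limit_ball /= (time_constant_axis s00 s0' h) => /negP; rewrite -ltNge => h1.
apply/negP; rewrite -ltNge; apply: (lt_le_trans h1).
by apply: ler_peMr; [exact: le_trans ler01 (ltW h1)|rewrite ler_pdivlMr // mul1r].
Qed.

End axis.

(** * Pivotal edges and routes *)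

Section routes.
Variables (R : realType) (d : nat) (D : {fset vertex d}) (B : set (vertex d)).
Implicit Types (e : edge d) (w : edge d -> bool) (g : steps d) (p : R).

Definition crossings : set (steps d) :=
  [set g | path_in [set` D] 0 g /\ B (path_end 0 g)].

Definition crossing_time w : R := inf [set path_time R w g | g in crossings].

Definition optimal w g := crossings g /\ path_time R w g = crossing_time w.

Definition on_route e w := w e /\ exists g, optimal w g /\ e \in unzip1 g.

Lemma path_in_inside u g e : path_in [set` D] u g -> e \in unzip1 g -> inside D e.
Proof.
elim: g u => // -[f x] g IH u /path_in_cons[uD j xg] /=.
rewrite inE => /predU1P[->|]; last exact: IH xg.
apply/(inside_joins _ j); split=> //; by case: xg => _; apply; rewrite inE eqxx.
Qed.

Lemma crossings_agree w w' g : (forall e, inside D e -> w e = w' e) ->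
  crossings g -> path_time R w g = path_time R w' g.
Proof.
move=> ww' [gD _]; rewrite !path_time_cost; congr (_%:R).
by apply: eq_in_count => e /(path_in_inside gD)/ww' ->.
Qed.

Lemma local_crossing_time : local_on (inside D) crossing_time.
Proof.
move=> w w' ww'; rewrite /crossing_time; congr inf.
by apply/seteqP; split=> _ [g gA <-]; exists g => //; rewrite (crossings_agree ww').
Qed.

Lemma local_on_route e : inside D e -> local_on (inside D) (fun w => `[< on_route e w >]).
Proof.
move=> eD w w' ww'; apply: asbool_equiv_eq.
rewrite /on_route ww' //; split=> -[we [g [[gA gT] eg]]]; split=> //; exists g; split=> //.
  by split=> //; rewrite -(crossings_agree ww') // gT (local_crossing_time ww').
by split=> //; rewrite (crossings_agree ww') // gT (local_crossing_time ww').
Qed.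

Lemma cost_upd_lt w g e : w e -> e \in unzip1 g -> (cost (upd w e false) g < cost w g)%N.
Proof.
move=> we; have sub f : upd w e false f -> w f by rewrite /upd; case: eqP.
rewrite /cost; elim: (unzip1 g) => //= f r IH; rewrite inE.
have [ef|ef] := eqVneq e f.
  by subst f; move=> _; rewrite {1}/upd eqxx we add0n add1n ltnS sub_count.
by move=> /= /IH h; rewrite {1}/upd eq_sym (negbTE ef) ltn_add2l.
Qed.

(** Making a closed edge of a route free saves time. *)
Lemma on_route_pivotal e w : on_route e w ->
  w e /\ crossing_time (upd w e false) < crossing_time (upd w e true).
Proof.
move=> [we [g [[gA gT] eg]]]; split=> //; have we' : w e = true := we.
have -> : upd w e true = w by rewrite -{2}(upd_id w e) we'.
rewrite -gT.
apply: le_lt_trans (inf_times_le R (upd w e false) gA) _.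
by rewrite !path_time_cost ltr_nat cost_upd_lt.
Qed.

(** A route that misses an edge keeps its cost when that edge is closed, so an open
    edge whose closing costs time lies on every route. *)
Lemma open_pivotal_in_optimal e w g : w e = false ->
  crossing_time (upd w e false) < crossing_time (upd w e true) ->
  optimal w g -> e \in unzip1 g.
Proof.
move=> we; have -> : upd w e false = w by rewrite -{2}(upd_id w e) we.
move=> lt [gA gT]; apply: contraLR lt => eg; rewrite -leNgt -gT; apply: le_trans (inf_times_le R (upd w e true) gA) _.
rewrite !path_time_cost ler_nat /cost; apply/eq_leq/eq_in_count => f fg.
by rewrite /upd; case: eqP => // fe; move: eg; rewrite -fe fg.
Qed.

Definition pivotal e w : bool :=
  crossing_time (upd w e false) < crossing_time (upd w e true).

Lemma local_pivotal e : local_on (~` [set e]) (fun w => (pivotal e w)%:R : R).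
Proof.
have K b w w' : (forall f, (~` [set e]) f -> w f = w' f) -> upd w e b = upd w' e b.
  by move=> ww'; apply/funext => f; rewrite /upd; case: eqP => // /ww'.
by move=> w w' ww'; rewrite /pivotal !(K _ w w').
Qed.

(** Whether an edge is pivotal does not depend on its own state: pivotal edges are
    closed with probability 1 - p and open with probability p. *)
Lemma pivotal_exchange p s e w : e \in s ->
  p * mean p s (fun w => (w e && pivotal e w)%:R) w =
  (1 - p) * mean p s (fun w => (~~ w e && pivotal e w)%:R) w.
Proof.
move=> es.
have loc b : local_on [set e] (fun w : edge d -> bool => (w e == b)%:R : R).
  by move=> u u' uu'; rewrite uu'.
have me b : mean p s (fun w : edge d -> bool => (w e == b)%:R) w = if b then 1 - p else p.
  rewrite (mean_local (s' := [:: e]) p w w (loc b)) => [|? ->//|? ->]; last by rewrite inE eqxx.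
  by rewrite /= /upd eqxx; case: b => /=; ring.
have E b : mean p s (fun w => ((w e == b) && pivotal e w)%:R) w =
    (if b then 1 - p else p) * mean p s (fun w => (pivotal e w)%:R) w.
  rewrite -me -(mean_indep p s w (loc b) (@local_pivotal e)) => [|? -> h]; last exact: h.
  by congr mean; apply/funext => u; rewrite -mulnb natrM.
have Et : (fun w => (w e && pivotal e w)%:R : R) = fun w => ((w e == true) && pivotal e w)%:R.
  by apply/funext => u; rewrite eqb_id.
have Ef : (fun w => (~~ w e && pivotal e w)%:R : R) = fun w => ((w e == false) && pivotal e w)%:R.
  by apply/funext => u; rewrite eqbF_neg.
by rewrite Et Ef !E; ring.
Qed.

Lemma optimal_exists w g0 : crossings g0 ->
  exists g, optimal w g /\ (cost w g <= cost w g0)%N.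
Proof.
move=> g0A; have ex : exists n, `[< exists g, crossings g /\ cost w g = n >].
  by exists (cost w g0); apply/asboolP; exists g0.
case: (ex_minnP ex) => n /asboolP[g [gA gn]] nmin.
have gmin h : crossings h -> (cost w g <= cost w h)%N.
  by move=> hA; rewrite gn; apply: nmin; apply/asboolP; exists h.
exists g; split; last exact: gmin.
split=> //; apply/eqP; rewrite eq_le inf_times_le // andbT.
apply: lb_le_inf; first by exists (path_time R w g0), g0.
by move=> _ [h hA <-]; rewrite !path_time_cost ler_nat; exact: gmin.
Qed.

Definition open_pivotals s w : nat := count (fun e => ~~ w e && pivotal e w) s.

(** All open pivotal edges lie on any given route. *)
Lemma open_pivotals_le_size s w g : uniq s -> optimal w g -> (open_pivotals s w <= size g)%N.
Proof.
move=> us gO; rewrite -(size_map fst g) -/(unzip1 g) /open_pivotals -size_filter.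
apply: uniq_leq_size; first exact: filter_uniq.
move=> e; rewrite mem_filter => /andP[/andP[/negbTE we pe] _].
exact: open_pivotal_in_optimal we pe gO.
Qed.

Section mean_open_pivotals.
Variables (p lam : R) (S : {fset vertex d}) (a k : nat).
Hypothesis p01 : 0 <= p <= 1.
Hypothesis S0 : 0 \in S.
Hypothesis lam01 : 0 < lam <= 1.
Notation rho := (chain_rate p lam S).
Hypothesis rho01 : 0 <= rho < 1.
Hypothesis rho_a : rho ^+ a <= lam.

(** As long as no chain of length m reaches weight lam^k there is a route of at most
    m #|S| steps.  Lengths up to a k are free, and each further length at which the
    threshold is reached contributes at least 1 to the sum. *)
Lemma open_pivotals_le_chains s w g0 : uniq s -> crossings g0 -> (size g0 <= k)%N ->
  (open_pivotals s w)%:R <= #|` S|%:R *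
    ((a * k)%:R + \sum_(i < size s) lam ^- k * chain lam S (a * k + i) D 0 w).
Proof.
move=> us g0A g0k; have /andP[l0 l1] := lam01.
have lk0 : 0 < lam ^+ k by exact: exprn_gt0.
have [g [gO gc]] := optimal_exists w g0A.
have gk : (cost w g <= k)%N by rewrite (leq_trans gc) // (leq_trans (count_size _ _)) // size_map.
have S1 : 1 <= #|` S|%:R :> R by rewrite ler1n cardfs_gt0; apply/fset0Pn; exists 0.
have short m : chain lam S m D 0 w < lam ^+ k -> (open_pivotals s w <= m * #|` S|)%N.
  move=> hm; have [gA gT] := gO; have [gD gB] := gA.
  have [[h [hD hB hc hs]]|h] := short_or_chain S0 lam01 (B := B) m w gD gB.
    apply: leq_trans hs; apply: open_pivotals_le_size => //; split; first by split.
    apply/eqP; rewrite eq_le -{1}gT !path_time_cost ler_nat hc /=.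
    by rewrite -path_time_cost; apply: inf_times_le.
  move: hm; rewrite ltNge => /negP; case; apply: le_trans h.
  by rewrite ler_wiXn2l // ltW.
have pos i : 0 <= lam ^- k * chain lam S (a * k + i) D 0 w.
  by rewrite mulr_ge0 ?chain_ge0 // invr_ge0 ltW.
(* either some length a k + i with i < size s is short, or all these lengths are
   charged, which already accounts for every edge of s *)
suff [h|h] : (open_pivotals s w)%:R <= #|` S|%:R *
    ((a * k)%:R + \sum_(i < size s) lam ^- k * chain lam S (a * k + i) D 0 w) \/
  (size s)%:R <= \sum_(i < size s) lam ^- k * chain lam S (a * k + i) D 0 w.
- exact: h.
- apply: le_trans (_ : (size s)%:R <= _); first by rewrite ler_nat count_size.
  apply: le_trans h _; rewrite -[leLHS]mul1r; apply: ler_pM => //.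
    by apply: sumr_ge0 => i _; exact: pos.
  by rewrite lerDr.
elim: (size s) => [|j [IH|IH]]; first by right; rewrite big_ord0.
- left; apply: le_trans IH _; rewrite ler_wpM2l ?ler0n // lerD2l big_ord_recr /=.
  by rewrite lerDl.
have [hj|hj] := ltP (chain lam S (a * k + j) D 0 w) (lam ^+ k).
- left; have := short _ hj; rewrite mulnC -(ler_nat R) natrM natrD => h.
  apply: le_trans h _; rewrite ler_wpM2l // lerD2l (le_trans IH) //.
  by rewrite big_ord_recr /= lerDl.
- right; rewrite big_ord_recr /= -natr1 lerD // ler_pdivlMl // mulr1.
  exact: hj.
Qed.

(** The choice rho^a <= lam makes the penalty lam^-k harmless from length a k on,
    and the remaining terms are dominated by a geometric series. *)
Lemma mean_open_pivotals s w g0 : uniq s -> (forall e, inside D e -> e \in s) ->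
  crossings g0 -> (size g0 <= k)%N ->
  mean p s (fun w => (open_pivotals s w)%:R) w <=
  #|` S|%:R * ((a * k)%:R + (1 - rho)^-1).
Proof.
move=> us Ds g0A g0k; have /andP[l0 l1] := lam01; have /andP[r0 r1] := rho01.
have D0 : 0 \in D by case: g0A => -[_ /(_ 0)]; rewrite inE eqxx => /(_ isT).
have lk0 : 0 < lam ^+ k by exact: exprn_gt0.
apply: le_trans (le_mean s w p01 (fun w => open_pivotals_le_chains w us g0A g0k)) _.
rewrite mean_scale ler_wpM2l // mean_add mean_cst lerD2l mean_sum.
have geo n : \sum_(i < n) rho ^+ i <= (1 - rho)^-1.
  have r1' : 0 < 1 - rho by rewrite subr_gt0.
  have -> : \sum_(i < n) rho ^+ i = (1 - rho ^+ n) / (1 - rho).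
    apply: (mulIf (lt0r_neq0 r1')); rewrite divfK ?gt_eqF //.
    elim: n => [|n IH]; first by rewrite big_ord0 mul0r expr0 subrr.
    by rewrite big_ord_recr /= mulrDl IH exprSr; ring.
  by rewrite ler_pdivrMr // mulVf ?gt_eqF // gerBl exprn_ge0.
apply: le_trans (geo (size s)); apply: ler_sum => i _; rewrite mean_scale.
rewrite ler_pdivrMl //; apply: le_trans (mean_chain p01 S0 lam01 _ _ D0 Ds) _.
rewrite exprD ler_wpM2r ?exprn_ge0 // exprM.
by apply: lerXn2r; rewrite ?nnegrE ?exprn_ge0 // ltW.
Qed.

End mean_open_pivotals.

(** Closed pivotal edges are exchanged for open ones, edge by edge. *)
Lemma mean_on_route (p : R) s w : 0 < p <= 1 -> (forall e, inside D e -> e \in s) ->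
  p * (\sum_(e <- inside_seq D) mean p s (fun w => `[< on_route e w >]%:R) w) <=
  (1 - p) * mean p s (fun w => (open_pivotals (inside_seq D) w)%:R) w.
Proof.
move=> /andP[p0 p1] Ds; have p01 : 0 <= p <= 1 by rewrite ltW.
have -> : (fun w => (open_pivotals (inside_seq D) w)%:R : R) =
    fun w => \sum_(e <- inside_seq D) (~~ w e && pivotal e w)%:R.
  by apply/funext => u; rewrite /open_pivotals -sum1_count big_mkcond natr_sum /=;
    apply: eq_bigr => e _; case: ifP.
rewrite mean_sum !mulr_sumr big_seq [leRHS]big_seq; apply: ler_sum => e /mem_inside eD.
rewrite -(pivotal_exchange p w (Ds _ eD)); apply: ler_wpM2l; first exact: ltW.
apply: le_mean => // u; rewrite ler_nat; case: asboolP => // /on_route_pivotal[-> /= h].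
by rewrite /pivotal h.
Qed.

End routes.

(** * The number of route edges of a bounded domain *)

Section domain.
Variables (R : realType) (d : nat).
Implicit Types (G : set 'rV[R]_d).

Lemma bounded_le G : bounded_set G -> exists M : R, forall x, G x -> `|x| <= M.
Proof. by case=> M [_ hM]; exists (M + 1) => x Gx; apply: (hM (M + 1)); rewrite ?ltrDl. Qed.

Lemma coord_le_norm (x : 'rV[R]_d) i : `|x 0 i| <= `|x|.
Proof.
have -> : `|x| = mx_norm x by []; rewrite mx_normrE.
by apply: (le_bigmax _ (fun ij => `|x ij.1 ij.2|) (0, i)).
Qed.

Lemma finite_lattice_points G : bounded_set G -> finite_set (lattice_points G).
Proof.
move=> /bounded_le[M GM]; pose N := (Num.truncn `|M|).+1.
have MN : M <= N%:R by rewrite (le_trans (ler_norm _)) // ltW // truncnS_gt.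
(* coordinates in [- N, N] become natural numbers after a shift by N *)
pose h (f : {ffun 'I_d -> 'I_(2 * N).+1}) : vertex d := \row_i ((f i : nat)%:Z - N%:Z).
apply: (sub_finite_set (B := h @` setT)); last exact/finite_image/finite_finset.
move=> v /GM vM.
have vN i : `|v 0 i| <= N%:Z.
  have := le_trans (coord_le_norm _ i) (le_trans vM MN).
  by rewrite !mxE -intr_norm -[N%:R]/(N%:Z%:~R) ler_int.
have hb i : (absz (v 0%R i + N%:Z)%R < (2 * N).+1)%N.
  by have := vN i; lia.
exists [ffun i => Ordinal (hb i)] => //.
apply/rowP => i; rewrite !mxE ffunE /=; have := vN i; lia.
Qed.

(** All events involved depend on the finitely many edges inside the domain. *)
Lemma integral_num_route_edges (p : R) (P : probability (config d) R) G
    (D : {fset vertex d}) : is_product_measure p P ->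
  lattice_points G = [set` D] ->
  (\int[P]_w num_route_edges G w)%E =
  (\sum_(e <- inside_seq D) mean p (inside_seq D)
     (fun w => `[< on_route R D (inner_boundary [set` D]) e w >]%:R) (fun=> false))%:E.
Proof.
move=> Pp GD; set B := inner_boundary _.
have routeE w : route_edges G w = [set e | e \in [seq e <- inside_seq D | `[< on_route R D B e w >]]].
  apply/seteqP; split=> e.
    move=> [e1 e2 we [g [[gG gT] eg]]]; rewrite /= mem_filter; apply/andP; split.
      apply/asboolP; split; first by move: we; rewrite /passage; case: (w e) => // /eqP; rewrite eq_sym oner_eq0.
      exists g; split=> //; move: gG gT; rewrite /exit_paths /exit_time /exit_paths GD => gG gT.
      by split.
    by apply/mem_inside; move: e1 e2; rewrite GD.
  rewrite /= mem_filter => /andP[/asboolP[we [g [[gA gT] eg]]] /mem_inside[e1 e2]].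
  split; rewrite ?GD //; first by rewrite /passage we.
  by exists g; split=> //; rewrite /is_route /exit_time /exit_paths GD; split.
have numE w : num_route_edges G w =
    (\sum_(e <- inside_seq D) (\1_[set w : config d | `[< on_route R D B e w >]] w)%:E)%E.
  rewrite /num_route_edges routeE /counting asboolT; last exact: finite_seq.
  have -> : size (fset_set [set e | e \in [seq e <- inside_seq D | `[< on_route R D B e w >]]]) =
      count (fun e => `[< on_route R D B e w >]) (inside_seq D).
    rewrite -size_filter; apply/perm_size/uniq_perm; [exact: fset_uniq|exact/filter_uniq/uniq_inside|].
    move=> e; rewrite in_fset_set; last exact: finite_seq.
    by apply/idP/idP => [/set_mem//|h]; exact: mem_set.
  rewrite sumEFin -sum1_count big_mkcond natr_sum /=; congr (_%:E).
  apply: eq_bigr => e _; rewrite indicE; case: ifP => h.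
    by rewrite mem_set.
  by rewrite memNset //= h.
have ev e : e \in inside_seq D ->
    measurable [set w : config d | `[< on_route R D B e w >]] /\
    P [set w : config d | `[< on_route R D B e w >]] =
    (mean p (inside_seq D) (fun w => `[< on_route R D B e w >]%:R) (fun=> false))%:E.
  move=> /mem_inside eD; apply: (prob_local Pp (fun=> false) (uniq_inside D)).
  by apply: local_onS (@local_on_route R d D B e eD) => f fD; exact/mem_inside.
(* outside the summation range the event is irrelevant, and is made empty *)
pose A e := if e \in inside_seq D then [set w : config d | `[< on_route R D B e w >]] else set0.
have mA e : measurable (A e) by rewrite /A; case: ifP => // /ev[].
have -> : (\int[P]_w (num_route_edges G w))%E =
    (\int[P]_w (\sum_(e <- inside_seq D) (\1_(A e) w)%:E))%E.
  apply: eq_integral => w _; rewrite numE big_seq [RHS]big_seq.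
  by apply: eq_bigr => e eD; rewrite /A eD.
rewrite ge0_integral_sum //; last first.
  by move=> e; apply/measurable_EFinP; exact: measurable_indic.
rewrite -sumEFin big_seq [RHS]big_seq; apply: eq_bigr => e eD.
by rewrite integral_indic // setIT /A eD; exact: (ev e eD).2.
Qed.

End domain.

(** Since phi_p(S) < 1, a small enough penalty lam keeps the rate below 1. *)
Lemma chain_constants (R : realType) (d : nat) (p : R) (S : {fset vertex d}) :
  0 <= p <= 1 -> p * mean_exits p S < 1 ->
  exists lam : R, exists a : nat, [/\ 0 < lam <= 1, 0 <= chain_rate p lam S < 1 &
    chain_rate p lam S ^+ a <= lam].
Proof.
move=> p01 phi1; have /andP[p0 p1] := p01.
have phi0 : 0 <= p * mean_exits p S.
  rewrite mulr_ge0 //; apply: mean_ge0 => // w.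
  by apply: sumr_ge0 => x _; exact: dir_sum_ge0.
pose c : R := (#|{: 'I_d * bool}| * #|` S|)%:R.
have c0 : 0 <= c by exact: ler0n.
have c2 : 0 < 2 * (c + 1) by rewrite mulr_gt0 // ltr_wpDl.
(* closed exits may use up half of the gap between phi_p(S) and 1 *)
pose lam : R := Num.min 1 ((1 - p * mean_exits p S) / (2 * (c + 1))).
have l0 : 0 < lam by rewrite lt_min ltr01 divr_gt0 // subr_gt0.
have l1 : lam <= 1 by rewrite ge_min lexx.
have lc : lam * c <= (1 - p * mean_exits p S) / 2.
  have : lam <= (1 - p * mean_exits p S) / (2 * (c + 1)) by rewrite ge_min lexx orbT.
  rewrite ler_pdivlMr // => h.
  by rewrite ler_pdivlMr //; have := mulr_ge0 (ltW l0) c0; lra.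
have r01 : 0 <= chain_rate p lam S < 1.
  rewrite /chain_rate -/c; apply/andP; split; last by lra.
  by rewrite addr_ge0 // mulr_ge0 // ltW.
exists lam; have /andP[r0 r1] := r01.
have rn : `|chain_rate p lam S| < 1 by rewrite ger0_norm.
have /cvgr0Pnorm_lt /(_ _ l0)[N _ /(_ N (leqnn N))] := cvg_expr rn.
move=> /= h; exists N; rewrite l0; split=> //.
by rewrite (le_trans (ler_norm _)) // ltW.
Qed.

(** * The linear bound *)

Section bound.
Variables (R : realType) (d : nat) (p : R) (P : probability (config d) R) (i0 : 'I_d).
Hypothesis Pp : is_product_measure p P.
Hypothesis p01 : 0 < p < 1.
Variables (S : {fset vertex d}) (lam : R) (a : nat).
Hypothesis S0 : 0 \in S.
Hypothesis lam01 : 0 < lam <= 1.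
Notation rho := (chain_rate p lam S).
Hypothesis rho01 : 0 <= rho < 1.
Hypothesis rho_a : rho ^+ a <= lam.

Definition route_constant : R :=
  (1 - p) / p * (#|` S|%:R * (a%:R + (1 - rho)^-1)).

(** The straight path along the axis crosses the domain in k steps, so the crossing
    time is at most k.  The bound has no additive constant: for k = 0 the crossing
    time vanishes and no closed edge lies on a route. *)
Lemma integral_route_edges_le (G : set 'rV[R]_d) (k : nat) : bounded_set G ->
  (forall j, (j <= k)%N -> lattice_points G (axis i0 j)) ->
  ~ lattice_points G (axis i0 k.+1) ->
  (\int[P]_w num_route_edges G w <= (route_constant * k%:R)%:E)%E.
Proof.
move=> bG inG outG; have /andP[p0 p1] := p01; have /andP[r0 r1] := rho01.
have /finite_fsetP[D GD] := finite_lattice_points bG.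
have [g [gG gk gs]] := axis_path inG.
have gA : crossings D (inner_boundary [set` D]) g.
  split; first by rewrite -GD.
  rewrite -GD gk; split; first exact: inG.
  exists (axis i0 k.+1); split=> //; apply/adjacentP.
  by exists (ed (axis i0 k) (i0, true)); rewrite -nb_axis joins_ed.
rewrite (integral_num_route_edges Pp GD) lee_fin.
have p01' : 0 < p <= 1 by rewrite p0 ltW.
have p01'' : 0 <= p <= 1 by rewrite !ltW.
have Ds e : inside D e -> e \in inside_seq D by move=> eD; apply/mem_inside.
have ineq := mean_on_route (R := R) (inner_boundary [set` D]) (fun=> false) p01' Ds.
case: k inG outG gk gs gA => [|k] inG outG gk gs gA.
  rewrite mulr0 big1 // => e _.
  rewrite (_ : (fun w => _) = fun=> 0) ?mean_cst //; apply/funext => w.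
  case: asboolP => // -[we [h [[hA hT] eh]]].
  have : path_time R w h <= path_time R w g by rewrite hT; exact: inf_times_le.
  rewrite !path_time_cost ler_nat.
  have -> : cost w g = 0%N by case: (g) gs.
  rewrite leqn0 /cost -leqn0 leqNgt -has_count => /hasPn /(_ e eh).
  by rewrite we.
have k1 : 1 <= k.+1%:R :> R by rewrite ler1n.
have hN := mean_open_pivotals p01'' S0 lam01 rho01 rho_a (fun=> false) (uniq_inside D) Ds gA (eq_leq gs).
rewrite /route_constant.
have inv1 : 0 <= (1 - rho)^-1 by rewrite invr_ge0 subr_ge0 ltW.
rewrite -(ler_pM2l p0); apply: le_trans ineq _.
have -> : p * ((1 - p) / p * (#|` S|%:R * (a%:R + (1 - rho)^-1)) * k.+1%:R) =
    (1 - p) * (#|` S|%:R * (a%:R * k.+1%:R + (1 - rho)^-1 * k.+1%:R)).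
  by field; rewrite subr_eq0 eq_sym lt_eqF // gt_eqF.
apply: ler_wpM2l; first by rewrite subr_ge0 ltW.
apply: le_trans hN _; apply: ler_wpM2l => //.
by rewrite natrM lerD2l ler_peMr.
Qed.

End bound.

(** Were the whole half-axis in the limit ball, G would contain it too.  In
    particular the time constant along the axis is a true limit as soon as a bounded
    G contains a dilate of the limit ball. *)
Lemma limit_ball_unbounded_axis (R : realType) (d : nat) (i0 : 'I_d)
    (P : probability (config d) R) (t : R) (G : set 'rV[R]_d) :
  0 < t -> bounded_set G -> dilate (t / 2) (limit_ball P) `<=` G ->
  exists s0 : R, 0 < s0 /\ ~ limit_ball P (s0 *: axisR R i0).
Proof.
move=> t0 /bounded_le[M GM] BG; apply: contrapT => /forallNP h.
pose s0 := (`|M| + 1) / (t / 2).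
have s00 : 0 < s0 by rewrite divr_gt0 ?divr_gt0 // ltr_wpDl.
have : limit_ball P (s0 *: axisR R i0).
  by apply: contrapT => nb; apply: (h s0).
move=> Bs; have : G ((t / 2) *: (s0 *: axisR R i0)) by apply: BG; exists (s0 *: axisR R i0).
move=> /GM; have := coord_le_norm ((t / 2) *: (s0 *: axisR R i0)) i0.
rewrite !mxE !eqxx mulr1 mulrC divfK ?gt_eqF ?divr_gt0 // => h1 h2.
have := le_trans h1 h2; rewrite leNgt => /negP; apply.
have M1 : 0 <= `|M| + 1 by rewrite addr_ge0.
by rewrite (ger0_norm M1) (le_lt_trans (ler_norm M)) // ltrDl.
Qed.

Lemma limit_ball_unique (R : realType) (d : nat) (p : R)
    (P P' : probability (config d) R) :
  is_product_measure p P -> is_product_measure p P' ->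
  limit_ball P = limit_ball P'.
Proof.
move=> Pp P'p.
have ae Q Q' (A : set (config d)) : (forall X, measurable X -> Q X = Q' X) ->
    almost_everywhere (R := R) Q A -> almost_everywhere (R := R) Q' A.
  move=> QQ' [N [mN N0 AN]]; exists N; split=> //; by rewrite -QQ'.
apply/funext => x; rewrite /limit_ball /time_constant; congr (xget _ _ <= 1).
have e := is_product_measure_unique Pp P'p.
by apply/seteqP; split=> m /=; apply: ae => X mX; rewrite e.
Qed.

Theorem proposition4 (R : realType) (d : nat) (p : R) (hd : (2 <= d)%N)
    (hp : 0 < p < critical_probability R d) :
  exists C : R, forall P : probability (config d) R, is_product_measure p P ->
    forall (t : R) (G : set 'rV[R]_d), 0 < t -> connected G -> bounded_set G ->
      dilate (t / 2) (limit_ball P) `<=` G ->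
      G `<=` dilate (2 * t) (limit_ball P) ->
      (\int[P]_w num_route_edges G w <= (C * t)%:E)%E.
Proof.
have [p1 [S [S0 phi1]]] := critical_set hp; have /andP[p0 _] := hp.
have p01 : 0 < p < 1 by rewrite p0.
have p01' : 0 <= p <= 1 by rewrite !ltW.
have [lam [a [lam01 rho01 rho_a]]] := chain_constants p01' phi1.
pose i0 : 'I_d := Ordinal (ltnW hd).
pose K := route_constant p S lam a.
have K0 : 0 <= K.
  have /andP[r0 r1] := rho01.
  rewrite /K /route_constant; apply: mulr_ge0.
    by rewrite divr_ge0 ?(ltW p0) // subr_ge0 ltW.
  by rewrite mulr_ge0 // addr_ge0 // invr_ge0 subr_ge0 ltW.
(* if every measure has the whole half-axis in its limit ball, then no bounded G
   is admissible and any constant will do *)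
have [[P0 [P0p [s0 [s00 B0]]]]|none] := pselect (exists P : probability (config d) R,
    is_product_measure p P /\ exists s0 : R, 0 < s0 /\ ~ limit_ball P (s0 *: axisR R i0));
  last first.
  exists 0 => P Pp t G t0 _ bG BG _; case: none; exists P; split=> //.
  exact: limit_ball_unbounded_axis t0 bG BG.
exists (K * (2 * s0)) => P Pp t G t0 _ bG BG GB.
have outB k : lattice_points G (axis i0 k) -> k%:R <= 2 * s0 * t.
  move=> /GB[x Bx]; rewrite map_axis => xk; rewrite leNgt; apply/negP => lt.
  have t2 : 0 < 2 * t by rewrite mulr_gt0.
  have xE : x = (k%:R / (2 * t)) *: axisR R i0.
    by rewrite mulrC -scalerA -xk scalerA mulVf ?scale1r // gt_eqF.
  apply: (@limit_ball_axis R d i0 P0 (k%:R / (2 * t)) s0 s00 _ B0).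
    by rewrite ler_pdivlMr // mulrA [s0 * 2]mulrC ltW.
  by rewrite -xE (limit_ball_unique P0p Pp).
have ex : exists k, `[< ~ lattice_points G (axis i0 k) >].
  exists (Num.truncn (2 * s0 * t)).+1; apply/asboolP => /outB.
  by rewrite leNgt truncnS_gt.
case: (ex_minnP ex) => -[|k] /asboolP out kmin.
  have Kt : 0 <= K * (2 * s0) * t.
    apply: mulr_ge0; last exact: ltW.
    by apply: mulr_ge0 => //; apply: mulr_ge0 => //; exact: ltW.
  rewrite (eq_integral (cst 0%E)) ?integral0 ?lee_fin //.
  move=> w _; rewrite /num_route_edges.
  have -> : route_edges G w = set0.
    apply/seteqP; split=> // e [_ _ _ [g [[[[_ gG] _] _] _]]].
    by apply: out; apply: gG; rewrite inE eqxx.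
  by rewrite /counting asboolT // fset_set0.
have inG j : (j <= k)%N -> lattice_points G (axis i0 j).
  move=> jk; apply: contrapT => /asboolP /kmin; by rewrite ltnNge jk.
apply: le_trans (integral_route_edges_le Pp p01 S0 lam01 rho01 rho_a bG inG out) _.
rewrite lee_fin -mulrA; apply: ler_wpM2l => //; apply: outB; exact: inG.
Qed.
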